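(* For any labeled-weighted digraph $G$ with arcs labeled by $\{a,b\}$, possibly with double arcs, there are two different words $u,v\in\{a,b\}^+$ such that, for any pair $i,j$ of nodes of $G$, the highest weight of walks from $i$ to $j$ is the same for walks labeled $u$ and for walks labeled $v$. In addition, for any pair $i,j$ of nodes, if there is a unique walk of highest weight among the walks from $i$ to $j$ labeled $u$, then there is a unique walk of highest weight among the walks from $i$ to $j$ labeled $v$. Moreover, for every $n\ge 1$ there is a pair of different words $u,v\in\{a,b\}^+$ that has these properties simultaneously for all such digraphs $G$ with $n$ nodes.
   Context: $\{a,b\}^+$ is the set of nonempty finite words in the letters $a,b$. A labeled-weighted digraph, possibly with double arcs, has a finite node set $\{1,\dots,n\}$; for every ordered pair of nodes $(i,j)$ (including $i=j$) and every label in $\{a,b\}$ there is either no arc, a single arc, or a double arc from $i$ to $j$ with this label. Each arc has a weight in $\mathbb R$, and a double arc means two distinct parallel arcs from $i$ to $j$ with the same label and the same real weight. (Arcs from $i$ to $j$ with different labels may have different weights.) A walk from $i$ to $j$ is a nonempty finite sequence of arcs, starting at $i$ and ending at $j$, in which each arc starts at the end node of the previous one; two walks are equal only if they are the same sequence of arcs, so that using one or the other of the two arcs of a double arc gives different walks. A walk is labeled by the word formed by the labels of its successive arcs, and its weight is the (usual) sum of the weights of its arcs, counting repetitions. The highest weight over an empty set of walks is $-\infty$. *)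

(* Defs.v *)
From HB Require Import structures.
From mathcomp Require Import all_boot all_order all_algebra.
From mathcomp Require Import all_classical all_reals ereal.
Set Implicit Arguments.
Unset Strict Implicit.
Unset Printing Implicit Defensive.
Import Order.TTheory GRing.Theory Num.Theory.
Local Open Scope classical_set_scope.
Local Open Scope ring_scope.

(* The two letters a and b are the two booleans. *)
Definition letter : finType := bool.

Inductive connection (R : Type) : Type :=
  | NoArc
  | SingleArc of R
  | DoubleArc of R.
Arguments NoArc {R}.

Definition digraph (R : Type) (n : nat) : Type :=
  'I_n -> 'I_n -> letter -> connection R.

(* Source, target, label, and a bit telling apart the two copies of a double
   arc; a single arc only has the copy [false]. *)
Definition arc (n : nat) : finType := ('I_n * 'I_n * letter * bool)%type.

Definition src n (e : arc n) : 'I_n := e.1.1.1.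
Definition tgt n (e : arc n) : 'I_n := e.1.1.2.
Definition lab n (e : arc n) : letter := e.1.2.
Definition copy n (e : arc n) : bool := e.2.

Definition is_arc R n (G : digraph R n) (e : arc n) : bool :=
  match G (src e) (tgt e) (lab e) with
  | NoArc => false
  | SingleArc _ => ~~ copy e
  | DoubleArc _ => true
  end.

(* The value 0 is only a default for elements of [arc n] that are not arcs
   of G. *)
Definition arc_weight (R : realType) n (G : digraph R n) (e : arc n) : R :=
  match G (src e) (tgt e) (lab e) with
  | NoArc => 0
  | SingleArc r => r
  | DoubleArc r => r
  end.

Definition is_walk R n (G : digraph R n) (i j : 'I_n) (p : seq (arc n)) : bool :=
  if p is e :: q then
    [&& all (is_arc G) p, src e == i,
        path (fun e1 e2 => tgt e1 == src e2) e q & tgt (last e q) == j]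
  else false.

Definition walk_label n (p : seq (arc n)) : seq letter := [seq lab e | e <- p].

Definition walk_weight (R : realType) n (G : digraph R n) (p : seq (arc n)) : R :=
  \sum_(e <- p) arc_weight G e.

Definition walks R n (G : digraph R n) (i j : 'I_n) (w : seq letter) :
    set (seq (arc n)) :=
  [set p | is_walk G i j p /\ walk_label p = w].

(* The supremum of the empty set is -oo; otherwise it is a maximum, see
   [highest_weight_attained]. *)
Definition highest_weight (R : realType) n (G : digraph R n) (i j : 'I_n)
    (w : seq letter) : \bar R :=
  ereal_sup [set (walk_weight G p)%:E | p in walks G i j w].

Definition highest_walk (R : realType) n (G : digraph R n) (i j : 'I_n)
    (w : seq letter) (p : seq (arc n)) : Prop :=
  walks G i j w p /\ (walk_weight G p)%:E = highest_weight G i j w.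

Definition same_highest_weights (R : realType) n (G : digraph R n)
    (u v : seq letter) : Prop :=
  forall i j : 'I_n, highest_weight G i j u = highest_weight G i j v.

Definition unique_highest_walk_transfer (R : realType) n (G : digraph R n)
    (u v : seq letter) : Prop :=
  forall i j : 'I_n,
    (exists! p, highest_walk G i j u p) -> exists! q, highest_walk G i j v q.

Lemma highest_weight_empty (R : realType) n (G : digraph R n) i j w :
  walks G i j w = set0 -> highest_weight G i j w = -oo%E.
Proof. by move=> h; rewrite /highest_weight h image_set0 ereal_sup0. Qed.

Lemma finite_walks R n (G : digraph R n) i j w : finite_set (walks G i j w).
Proof.
apply: (@sub_finite_set _ _ (range (fun t : (size w).-tuple (arc n) => tval t))).
  move=> p [_ pw].
  have sp : size p == size w by rewrite -pw size_map.
  by exists (Tuple sp).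
exact/finite_image/finite_finset.
Qed.

Lemma highest_weight_attained (R : realType) n (G : digraph R n) i j w :
  walks G i j w !=set0 -> exists p, highest_walk G i j w p.
Proof.
move=> [p0 wp0].
have /finite_seqP[s sE] := finite_walks G i j w.
have p0s : p0 \in s by have : [set` s] p0 by rewrite -sE.
pose f (k : 'I_(size s)) := walk_weight G (nth p0 s k).
have k0 : (index p0 s < size s)%N by rewrite index_mem.
case: (Order.TotalTheory.arg_maxP f (i0 := Ordinal k0) (P := predT)) => // k _ kmax.
have wk : walks G i j w (nth p0 s k) by rewrite sE /=; exact: mem_nth.
exists (nth p0 s k); split=> //.
apply/eqP; rewrite eq_le; apply/andP; split.
  by apply: ereal_sup_ubound; exists (nth p0 s k).
apply: ge_ereal_sup => _ [q wq <-]; rewrite lee_fin.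
have qs : q \in s by have : [set` s] q by rewrite -sE.
have q0 : (index q s < size s)%N by rewrite index_mem.
by have := kmax (Ordinal q0) isT; rewrite /f /= nth_index.
Qed.

(* Main.v *)
From HB Require Import structures.
Require Import Defs.
From mathcomp Require Import all_boot all_order all_algebra all_fingroup.
From mathcomp Require Import all_classical all_reals ereal.
From mathcomp Require Import ring lra zify.
Set Implicit Arguments.
Unset Strict Implicit.
Unset Printing Implicit Defensive.
Import Order.TTheory GRing.Theory Num.Theory.
Local Open Scope ring_scope.

(** Weights of walks are read off matrix products.  Over the supertropical
    semiring, whose elements are -oo and the real numbers flagged as reached
    once (tangible) or several times (ghost), the entry (i, j) of the product
    of the transfer matrices along a word holds both the highest weight of the
    walks from i to j with that label and the answer to whether the walk that
    reaches it is unique.  So it suffices to find, for every n, two different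
    words of the same length with equal values on all pairs of supertropical
    matrices of size n ([identity_exists]); this is done by induction on n.

    Let P and Q be words and consider walks labelled PQ at the time of the cut
    between P and Q.  A node s is avoidable there if for all end points some
    optimal walk is not at s at that time.  Then the highest weights for PQ
    are those of a product through the n - 1 other nodes, and the identity
    u = v of dimension n - 1 gives u(Rx, Ry)R = v(Rx, Ry)R with R = PQPQ, for
    any words x and y ([identity_padded]).  One PQ in R would do for the
    weights; the second one controls uniqueness.  If x = y holds to begin
    with, so does the padded identity.  Hence finitely many cuts can be
    treated one after another ([combine_eval]), and it remains to find an
    identity x = y valid when no node is avoidable at finitely many cuts of
    the form W^T | W^T.

    In that situation walks are rigid.  Some optimal walk along W^T W^T is
    forced to be at s in the middle.  If it repeats a node on both sides of
    the middle, at the same distance, the part in between can be shifted to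
    the left or to the right; the two new weights have mean the old one, so
    both new walks are optimal and again at s in the middle.  This makes s
    recur periodically, and every closed walk through s that leaves s is
    strictly worse than staying on the loops at s
    ([unavoidable_dominance]).  Counting the weight of all n orbits together
    shows that, along words in x = a^N and y = b^N, no optimal walk returns to
    a node that it has left ([no_return_words]).

    Finally A = xy and B = yx have the same diagonal.  Take a word in A and B
    that is periodic in a long window around its central letter, with a period
    that depends on whether this letter is A or B.  An optimal walk that
    changes node at the centre can be shifted to both sides, which gives two
    other optimal walks staying at different nodes during the central letter;
    so only the diagonal of the central letter counts ([centre_diagonal]) and
    A may be replaced by B there ([centred_identity]). *)

(** * The supertropical semiring *)

(** [None] is -oo, [Some (a, true)] a maximum a reached once and
    [Some (a, false)] a maximum a reached several times. *)
Definition supertrop (R : realDomainType) : Type := option (R * bool).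

HB.instance Definition _ (R : realDomainType) := Choice.on (supertrop R).

(** Comparison of values; the flags are ignored, so this is only a preorder. *)
Definition st_le (R : realDomainType) (x y : supertrop R) : bool :=
  match x, y with
  | None, _ => true
  | Some _, None => false
  | Some (a, _), Some (b, _) => a <= b
  end.

Notation "x ≼ y" := (st_le x y) (at level 70).
Notation "x ≺ y" := (~~ st_le y x) (at level 70).

Section Semiring.
Variable R : realDomainType.
Local Notation S := (supertrop R).
Implicit Types x y z : S.

Definition st_add x y : S :=
  match x, y with
  | None, _ => y
  | _, None => x
  | Some (a, p), Some (b, q) =>
      if a < b then y else if b < a then x else Some (a, false)
  end.

Definition st_mul x y : S :=
  match x, y with
  | Some (a, p), Some (b, q) => Some (a + b, p && q)
  | _, _ => None
  end.

Ltac st_cases :=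
  repeat (case: ltP => ? /=); rewrite ?andbF ?andbT //; try (exfalso; lra);
  repeat (congr (Some (_, _))); try lra.

Lemma st_addA : associative st_add.
Proof.
move=> [[a p]|] [[b q]|] [[c r]|] //=; last by case: ltP => // ?; case: ltP.
by st_cases.
Qed.

Lemma st_addC : commutative st_add.
Proof. by move=> [[a p]|] [[b q]|] //=; st_cases. Qed.

Lemma st_mulA : associative st_mul.
Proof. by move=> [[a p]|] [[b q]|] [[c r]|] //=; rewrite addrA andbA. Qed.

Lemma st_mulC : commutative st_mul.
Proof. by move=> [[a p]|] [[b q]|] //=; rewrite addrC andbC. Qed.

Lemma st_mul1 : left_id (Some (0, true) : S) st_mul.
Proof. by move=> [[a p]|] //=; rewrite add0r. Qed.

Lemma st_mulDl : left_distributive st_mul st_add.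
Proof.
move=> [[a p]|] [[b q]|] [[c r]|] //=.
  by rewrite !ltrD2r; st_cases.
by case: ltP => // ?; case: ltP.
Qed.

Lemma st_add0 : left_id (None : S) st_add. Proof. by []. Qed.
Lemma st_mul0 : left_zero (None : S) st_mul. Proof. by []. Qed.

HB.instance Definition _ := GRing.isNmodule.Build S st_addA st_addC st_add0.
HB.instance Definition _ :=
  GRing.Nmodule_isComNzSemiRing.Build S
    st_mulA st_mulC st_mul1 st_mulDl st_mul0 isT.

(** -oo counts as ghost, so that [ghost] turns products into disjunctions. *)
Definition ghost x : bool := if x is Some (_, true) then false else true.

Lemma st_le_refl x : x ≼ x.
Proof. by case: x => [[a p]|] /=. Qed.

Lemma st_le_trans y x z : x ≼ y -> y ≼ z -> x ≼ z.
Proof. by case: x y z => [[a p]|] [[b q]|] [[c r]|] //=; apply: le_trans. Qed.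

Lemma st_le_total x y : (x ≼ y) || (y ≼ x).
Proof. by case: x y => [[a p]|] [[b q]|] //=; apply: le_total. Qed.

Lemma st_ltW x y : x ≺ y -> x ≼ y.
Proof. by have := st_le_total x y; case: (y ≼ x) => //; rewrite orbF. Qed.

Lemma st_lt_le_trans y x z : x ≺ y -> y ≼ z -> x ≺ z.
Proof. by move=> xy yz; apply: contra xy; apply: st_le_trans. Qed.

Lemma st_le_lt_trans y x z : x ≼ y -> y ≺ z -> x ≺ z.
Proof. by move=> xy; apply: contra => zx; apply: st_le_trans xy. Qed.

Lemma st_le0 x : (x ≼ 0) = (x == 0).
Proof. by case: x => [[a p]|]. Qed.

Lemma st_addE x y : x + y = st_add x y. Proof. by []. Qed.
Lemma st_mulE x y : x * y = st_mul x y. Proof. by []. Qed.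

Lemma st_leD x y z : (x + y ≼ z) = (x ≼ z) && (y ≼ z).
Proof.
rewrite st_addE; case: x y z => [[a p]|] [[b q]|] [[c r]|] //=; rewrite ?andbT //.
  by case: ltP => ab /=; last case: ltP => ba /=; lra.
by case: ltP => ab //=; case: ltP.
Qed.

Lemma st_le_addE x y z : (z ≼ x + y) = (z ≼ x) || (z ≼ y).
Proof.
rewrite st_addE; case: x y z => [[a p]|] [[b q]|] [[c r]|] //=; rewrite ?orbF //.
  by case: ltP => ab /=; last case: ltP => ba /=; lra.
Qed.

Lemma st_lt_add_absorb x y : y ≺ x -> x + y = x.
Proof.
rewrite st_addE; case: x y => [[a p]|] [[b q]|] //=.
by rewrite -ltNge; case: (ltgtP a b).
Qed.

(** A value already reached twice hides every term that does not exceed it. *)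
Lemma ghost_add_absorb x y : ghost x -> y ≼ x -> x + y = x.
Proof.
rewrite st_addE; case: x y => [[a []]|] [[b q]|] //= _.
by case: (ltgtP b a).
Qed.

Lemma ghost_tie x y z : x ≼ y -> y ≼ x -> z ≼ x -> ghost (x + (y + z)).
Proof.
rewrite !st_addE; case: x y z => [[a p]|] [[b q]|] [[c r]|] //=.
  move=> ab ba ca; have -> : b = a by lra.
  by case: ltP => ?; [lra|case: ltP => ? /=; rewrite ltxx].
by move=> ab ba _; have -> : b = a by [lra]; rewrite ltxx.
Qed.

Lemma st_leM x x' y y' : x ≼ x' -> y ≼ y' -> x * y ≼ x' * y'.
Proof.
rewrite !st_mulE; case: x y x' y' => [[a p]|] [[b q]|] [[c r]|] [[d t]|] //=.
exact: lerD.
Qed.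

Lemma st_mul_eq0 x y : (x * y == 0) = (x == 0) || (y == 0).
Proof. by rewrite st_mulE; case: x y => [[a p]|] [[b q]|]. Qed.

Lemma st_lt_neq0 x y : x ≺ y -> y != 0.
Proof. by apply: contra => /eqP ->. Qed.

Lemma st_lt_leM x x' y y' : x ≺ x' -> y ≼ y' -> y' != 0 -> x * y ≺ x' * y'.
Proof.
rewrite !st_mulE; case: x y x' y' => [[a p]|] [[b q]|] [[c r]|] [[d t]|] //=.
by rewrite -!ltNge => ? ? _; lra.
Qed.

Lemma st_le_ltM x x' y y' : x ≼ x' -> y ≺ y' -> x' != 0 -> x * y ≺ x' * y'.
Proof. by move=> ? ? ?; rewrite [x * y]mulrC [x' * y']mulrC; apply: st_lt_leM. Qed.

Lemma st_prod_neq0 (I : Type) (r : seq I) (P : pred I) (F : I -> S) :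
  (forall i, P i -> F i != 0) -> \prod_(i <- r | P i) F i != 0.
Proof.
move=> h; apply: (big_ind (fun x : S => x != 0)) => //.
by move=> x y x0 y0; rewrite st_mul_eq0 negb_or x0.
Qed.

Lemma st_leM_prod (I : Type) (r : seq I) (P : pred I) (F G : I -> S) :
  (forall i, P i -> F i ≼ G i) ->
  \prod_(i <- r | P i) F i ≼ \prod_(i <- r | P i) G i.
Proof.
move=> h; apply: (big_ind2 (fun x y : S => x ≼ y)) => //; first exact: st_le_refl.
by move=> x1 x2 y1 y2; apply: st_leM.
Qed.

Lemma st_ltM_prod (I : finType) (F G : I -> S) (i0 : I) :
  (forall i, F i ≼ G i) -> F i0 ≺ G i0 -> (forall i, G i != 0) ->
  \prod_i F i ≺ \prod_i G i.
Proof.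
move=> h h0 G0; rewrite (bigD1 i0) //= [\prod_i F i](bigD1 i0) //=.
by apply: st_lt_leM => //; [apply: st_leM_prod|apply: st_prod_neq0].
Qed.

Lemma st_sum_le (I : finType) (P : pred I) (F : I -> S) z :
  (\sum_(i | P i) F i ≼ z) = [forall (i | P i), F i ≼ z].
Proof.
apply/idP/forall_inP => [h i Pi|h].
  by move: h; rewrite (bigD1 i) //= st_leD => /andP[].
by apply: (big_ind (fun x => x ≼ z)) => // x y; rewrite st_leD => -> ->.
Qed.

Lemma st_le_sum (I : finType) (P : pred I) (F : I -> S) i :
  P i -> F i ≼ \sum_(i | P i) F i.
Proof. by move=> Pi; rewrite (bigD1 i) //= st_le_addE st_le_refl. Qed.

Lemma st_sum_attained (I : finType) (P : pred I) (F : I -> S) z :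
  z != 0 -> z ≼ \sum_(i | P i) F i -> exists2 i, P i & z ≼ F i.
Proof.
move=> z0; apply: (big_ind (fun x : S => z ≼ x -> exists2 i, P i & z ≼ F i)).
- by rewrite st_le0 (negPf z0).
- by move=> x y hx hy; rewrite st_le_addE => /orP[].
- by move=> i Pi zi; exists i.
Qed.

Lemma ghost_sum (I : finType) (F : I -> S) i k :
  i != k -> (forall l, F l ≼ F i) -> F i ≼ F k -> ghost (\sum_l F l).
Proof.
move=> ik h hk; rewrite (bigD1 i) //= (bigD1 k) 1?eq_sym //=.
by apply: ghost_tie => //; rewrite st_sum_le; apply/forall_inP => l _.
Qed.

Lemma ghostM x y : ghost (x * y) = ghost x || ghost y.
Proof. by rewrite st_mulE; case: x y => [[a []]|] [[b []]|]. Qed.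

(** x is recovered from two elements of the same value, and is ghost as soon as
    one of them is.  This relation is closed under sums and products, hence
    under matrix products, which makes it possible to compute a product from
    two of its variants. *)
Definition glued x x1 x2 : bool :=
  [&& x ≼ x1, x1 ≼ x, x ≼ x2, x2 ≼ x & ghost x == ghost x1 || ghost x2].

Lemma glued_refl x : glued x x x.
Proof. by rewrite /glued !st_le_refl orbb eqxx. Qed.

Lemma gluedM x x1 x2 y y1 y2 :
  glued x x1 x2 -> glued y y1 y2 -> glued (x * y) (x1 * y1) (x2 * y2).
Proof.
move=> /and5P[a1 a2 a3 a4 /eqP a5] /and5P[b1 b2 b3 b4 /eqP b5].
by rewrite /glued !st_leM // !ghostM a5 b5 /= orbACA.
Qed.

Lemma ghostD x y :
  ghost (x + y) = if x ≼ y then (y ≼ x) || ghost y else ghost x.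
Proof.
rewrite st_addE; case: x y => [[a p]|] [[b q]|] //=.
by case: (ltgtP a b).
Qed.

Lemma gluedD x x1 x2 y y1 y2 :
  glued x x1 x2 -> glued y y1 y2 -> glued (x + y) (x1 + y1) (x2 + y2).
Proof.
have leE (a a' b b' : S) : a ≼ a' -> a' ≼ a -> b ≼ b' -> b' ≼ b ->
    (a ≼ b) = (a' ≼ b').
  move=> aa a'a bb b'b; apply/idP/idP => h.
    exact: st_le_trans a'a (st_le_trans h bb).
  exact: st_le_trans aa (st_le_trans h b'b).
move=> /and5P[a1 a2 a3 a4 /eqP a5] /and5P[b1 b2 b3 b4 /eqP b5].
rewrite /glued !st_leD !st_le_addE a1 a2 a3 a4 b1 b2 b3 b4 !orbT /=.
rewrite !ghostD -(leE x x1 y y1) // -(leE y y1 x x1) //.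
rewrite -(leE x x2 y y2) // -(leE y y2 x x2) // a5 b5.
by case: (x ≼ y) => //; case: (y ≼ x).
Qed.

Lemma glued_sum (I : finType) (F F1 F2 : I -> S) :
  (forall i, glued (F i) (F1 i) (F2 i)) ->
  glued (\sum_i F i) (\sum_i F1 i) (\sum_i F2 i).
Proof.
move=> h; apply: (big_rec3 (fun a b c => glued a b c)); first exact: glued_refl.
by move=> i a b c _; apply: gluedD.
Qed.

Lemma glued_inj x y x1 x2 : glued x x1 x2 -> glued y x1 x2 -> x = y.
Proof.
move=> /and5P[a1 a2 _ _ /eqP a5] /and5P[b1 b2 _ _ /eqP b5].
have xy := st_le_trans a1 b2; have yx := st_le_trans b1 a2.
have : ghost x = ghost y by rewrite a5 b5.
by case: x y xy yx {a1 a2 a5 b1 b2 b5} => [[a []]|] [[b []]|] //= ab ba _;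
  congr (Some (_, _)); apply: le_anti; rewrite ab.
Qed.

End Semiring.

(** * Words, matrices and identities *)

Section Words.
Variable R : realDomainType.
Local Notation S := (supertrop R).

Definition eval n (L : Type) (M : L -> 'M[S]_n) (w : seq L) : 'M[S]_n :=
  \prod_(z <- w) M z.

Lemma eval_cat n L (M : L -> 'M[S]_n) u v :
  eval M (u ++ v) = eval M u * eval M v.
Proof. exact: big_cat. Qed.

Lemma eval_cons n L (M : L -> 'M[S]_n) z v : eval M (z :: v) = M z * eval M v.
Proof. exact: big_cons. Qed.

Definition subst (L L' : Type) (f : L -> seq L') (w : seq L) : seq L' :=
  flatten (map f w).

Lemma eval_subst n L L' (f : L -> seq L') (M : L' -> 'M[S]_n) w :
  eval M (subst f w) = eval (eval M \o f) w.
Proof. by rewrite /eval /subst big_flatten big_map. Qed.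

Lemma eval_ext n L (M M' : L -> 'M[S]_n) w : M =1 M' -> eval M w = eval M' w.
Proof. by move=> h; apply: eq_bigr => z _. Qed.

Definition identity n (u v : seq bool) : Prop :=
  forall M : bool -> 'M[S]_n, eval M u = eval M v.

(** A word in the matrices C K_z, followed by C, is C followed by the same word
    in the matrices K_z C, which are square of size n. *)
Lemma identity_factor m n (C : 'M[S]_(m, n)) (K : bool -> 'M[S]_(n, m)) u v :
  identity n u v ->
  eval (fun z => C *m K z) u *m C = eval (fun z => C *m K z) v *m C.
Proof.
move=> h.
suff e w : eval (fun z => C *m K z) w *m C = C *m eval (fun z => K z *m C) w.
  by rewrite !e h.
elim: w => [|z w IH]; first by rewrite /eval !big_nil mul1mx mulmx1.
by rewrite !eval_cons -mulmxA IH !mulmxA.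
Qed.

Definition glued_mx n (X X1 X2 : 'M[S]_n) :=
  forall i j, glued (X i j) (X1 i j) (X2 i j).

Lemma glued_mxM n (X X1 X2 Y Y1 Y2 : 'M[S]_n) :
  glued_mx X X1 X2 -> glued_mx Y Y1 Y2 -> glued_mx (X * Y) (X1 * Y1) (X2 * Y2).
Proof.
by move=> hX hY i j; rewrite !mxE; apply: glued_sum => k; apply: gluedM.
Qed.

Lemma glued_mx_refl n (X : 'M[S]_n) : glued_mx X X X.
Proof. by move=> i j; apply: glued_refl. Qed.

Lemma glued_eval n (M M1 M2 : bool -> 'M[S]_n) w :
  (forall z, glued_mx (M z) (M1 z) (M2 z)) ->
  glued_mx (eval M w) (eval M1 w) (eval M2 w).
Proof.
move=> h; rewrite /eval.
apply: (big_rec3 (fun X Y Z => glued_mx X Y Z)); first exact: glued_mx_refl.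
by move=> z X Y Z _; apply: glued_mxM.
Qed.

(** The walks that cross the cut between P and Q at a node other than s. *)
Definition avoid n (s : 'I_n.+1) (P Q : 'M[S]_n.+1) : 'M[S]_n.+1 :=
  col' s P *m row' s Q.

Definition avoidable n (s : 'I_n.+1) (P Q : 'M[S]_n.+1) : bool :=
  [forall i, [forall j, (P * Q) i j ≼ avoid s P Q i j]].

Lemma avoidE n (s : 'I_n.+1) (P Q : 'M[S]_n.+1) i j :
  (P * Q) i j = avoid s P Q i j + P i s * Q s j.
Proof.
rewrite !mxE (bigD1_ord s) //= addrC; congr (_ + _).
by apply: eq_bigr => k _; rewrite !mxE.
Qed.

(** Going through s can only turn a tangible entry into a ghost: the entry is a
    tie if it is one among the walks that avoid s, or if such a walk ties with
    a walk through s.  The second case is what the entry itself remembers. *)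
Lemma avoid_glued n (s : 'I_n.+1) (P Q : 'M[S]_n.+1) i j :
  avoidable s P Q -> glued ((P * Q) i j) (avoid s P Q i j) ((P * Q) i j).
Proof.
move=> /forallP /(_ i) /forallP /(_ j); rewrite (avoidE s); set d := avoid _ _ _ _ _ => hd.
rewrite /glued !st_le_refl hd st_le_addE st_le_refl /=.
move: hd; rewrite st_leD st_le_refl /= => hd.
by case gd: (ghost d); [rewrite ghost_add_absorb ?gd | rewrite eqxx].
Qed.

Lemma gluedC (x x1 x2 : S) : glued x x1 x2 -> glued x x2 x1.
Proof. by move=> /and5P[a b c d]; rewrite /glued a b c d orbC. Qed.

Definition padded (r x y : seq bool) (u : seq bool) : seq bool :=
  subst (fun z => r ++ if z then x else y) u ++ r.

(** With E = PQ, every factor EE of the product may be replaced by DE or by ED,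
    where D avoids s.  Each replacement gives a product to which the identity
    in dimension n applies.  The original product is glued from these two: a
    tie at a first E is a tie of the variant that keeps this E, and likewise
    for the second one. *)
Lemma identity_padded n u v (M : bool -> 'M[S]_n.+1) s p q x y :
  identity n u v -> avoidable s (eval M p) (eval M q) ->
  eval M (padded (p ++ q ++ p ++ q) x y u) =
  eval M (padded (p ++ q ++ p ++ q) x y v).
Proof.
move=> huv av.
set P := eval M p; set Q := eval M q; set E := P * Q; set D := avoid s P Q.
pose Z (z : bool) := eval M (if z then x else y).
pose F1 w := eval (fun z => D * (E * Z z)) w * (D * E).
pose F2 w := eval (fun z => E * (D * Z z)) w * (E * D).
have gD : glued_mx E D E by move=> i j; apply: avoid_glued.
have gD' : glued_mx E E D by move=> i j; apply/gluedC/avoid_glued.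
have evR : eval M (p ++ q ++ p ++ q) = E * E by rewrite !eval_cat mulrA.
have gl w : glued_mx (eval M (padded (p ++ q ++ p ++ q) x y w)) (F1 w) (F2 w).
  rewrite /padded eval_cat eval_subst evR.
  rewrite (eval_ext (M' := fun z => E * (E * Z z))); last first.
    by move=> z; rewrite /= eval_cat evR mulrA.
  apply: glued_mxM; last exact: glued_mxM gD gD'.
  apply: glued_eval => z; apply: glued_mxM gD (glued_mxM gD' _).
  exact: glued_mx_refl.
have F1E w : F1 w = eval (fun z => col' s P *m (row' s Q *m (E * Z z))) w
    *m col' s P *m (row' s Q *m E).
  rewrite /F1 (eval_ext (M' := fun z => col' s P *m (row' s Q *m (E * Z z)))).
    by rewrite -[RHS]mulmxA [col' s P *m _]mulmxA.
  by move=> z; rewrite mulmxA.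
have F2E w : F2 w = eval (fun z => E *m col' s P *m (row' s Q *m Z z)) w
    *m (E *m col' s P) *m row' s Q.
  rewrite /F2 (eval_ext (M' := fun z => E *m col' s P *m (row' s Q *m Z z))).
    by rewrite -[RHS]mulmxA -[E *m _ *m _]mulmxA.
  by move=> z; rewrite -[RHS]mulmxA [col' s P *m _]mulmxA.
apply/matrixP => i j; apply: glued_inj (gl u i j) _.
rewrite F1E F2E !(identity_factor _ _ huv) -F1E -F2E; exact: gl.
Qed.

End Words.

(** * Paths and the shift exchange *)

Section Paths.
Variable R : realDomainType.
Local Notation S := (supertrop R).
Variable n : nat.
Implicit Types (W : nat -> 'M[S]_n) (g : nat -> 'I_n).

(** A path is a sequence of nodes indexed by time; W t is the matrix read between
    the times t and t + 1.  Only the times from a to b matter. *)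
Definition path_weight W g a b : S := \prod_(a <= t < b) W t (g t) (g t.+1).
Definition range_prod W a b : 'M[S]_n := \prod_(a <= t < b) W t.

Lemma path_weight_cat W g a b c : (a <= b)%N -> (b <= c)%N ->
  path_weight W g a c = path_weight W g a b * path_weight W g b c.
Proof. exact: big_cat_nat. Qed.

Lemma range_prod_cat W a b c : (a <= b)%N -> (b <= c)%N ->
  range_prod W a c = range_prod W a b * range_prod W b c.
Proof. exact: big_cat_nat. Qed.

Lemma mul_entry_le (X Y : 'M[S]_n) i k j : X i k * Y k j ≼ (X * Y) i j.
Proof. by rewrite mxE; apply: (@st_le_sum R _ xpredT (fun k => X i k * Y k j)). Qed.

Lemma mul_entry_attained (X Y : 'M[S]_n) i j z :
  z != 0 -> z ≼ (X * Y) i j -> exists k, z ≼ X i k * Y k j.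
Proof.
by rewrite mxE => z0 /(st_sum_attained z0)[k _ h]; exists k.
Qed.

Lemma eq_path_weight W g g' a b :
  (forall t, (a <= t <= b)%N -> g t = g' t) ->
  path_weight W g a b = path_weight W g' a b.
Proof.
by move=> h; apply: eq_big_nat => t /andP[at_ tb]; rewrite !h //; lia.
Qed.

Lemma path_weight_le W g a b : (a <= b)%N ->
  path_weight W g a b ≼ range_prod W a b (g a) (g b).
Proof.
rewrite /path_weight /range_prod; elim: b => [|b IH].
  by rewrite leqn0 => /eqP ->; rewrite !big_geq // mxE eqxx st_le_refl.
rewrite leq_eqVlt => /orP[/eqP ->|]; first by rewrite !big_geq // mxE eqxx st_le_refl.
rewrite ltnS => ab; rewrite !big_nat_recr //=.
apply: st_le_trans (mul_entry_le _ _ _ (g b) _).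
by apply: st_leM; [exact: IH|exact: st_le_refl].
Qed.

Lemma path_attained W a b i j : (a <= b)%N -> range_prod W a b i j != 0 ->
  exists g, [/\ g a = i, g b = j & range_prod W a b i j ≼ path_weight W g a b].
Proof.
have base i' j' : range_prod W a a i' j' != 0 ->
    exists g, [/\ g a = i', g a = j' & range_prod W a a i' j' ≼ path_weight W g a a].
  rewrite /range_prod /path_weight; rewrite !big_geq // mxE.
  case: (i' =P j') => [<- _|]; last by rewrite eqxx.
  by exists (fun=> i'); rewrite big_geq // st_le_refl.
elim: b j => [|b IH] j.
  by rewrite leqn0 => /eqP a0; rewrite a0 in base *; apply: base.
rewrite leq_eqVlt => /orP[/eqP <-|]; first exact: base.
rewrite ltnS => ab.
rewrite (@range_prod_cat _ a b b.+1) //.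
have -> : range_prod W b b.+1 = W b by rewrite /range_prod big_nat1.
move=> h0; have [k hk] := mul_entry_attained h0 (st_le_refl _).
have : range_prod W a b i k != 0.
  by apply: contra h0 => /eqP e; rewrite -st_le0 (st_le_trans hk) // e mul0r st_le_refl.
move=> /(IH _ ab)[g [ga gb hg]].
exists (fun t => if (t <= b)%N then g t else j); rewrite ab ltnn; split=> //.
apply: st_le_trans hk _; rewrite (@path_weight_cat _ _ a b b.+1) //.
apply: st_leM.
  apply: st_le_trans hg _.
  rewrite (@eq_path_weight _ _ g) ?st_le_refl // => t /andP[_ tb].
  by rewrite tb.
by rewrite /path_weight big_nat1 leqnn ltnn gb st_le_refl.
Qed.

Definition optimal W a b g : bool :=
  (range_prod W a b (g a) (g b) != 0)
  && (range_prod W a b (g a) (g b) ≼ path_weight W g a b).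

Lemma optimal_neq0 W a b g : (a <= b)%N -> optimal W a b g ->
  path_weight W g a b != 0.
Proof.
move=> ab /andP[h0 h]; apply: contra h0 => /eqP e.
by move: h; rewrite e st_le0.
Qed.

(** A better segment could be substituted, and would improve the whole. *)
Lemma optimal_sub W a b c d g : (a <= b)%N -> (b <= c)%N -> (c <= d)%N ->
  optimal W a d g -> optimal W b c g.
Proof.
move=> ab bc cd og.
have ad := leq_trans ab (leq_trans bc cd).
have := optimal_neq0 ad og.
rewrite (@path_weight_cat _ _ a b d) ?(leq_trans bc) //.
rewrite (@path_weight_cat _ _ b c d) // !st_mul_eq0 !negb_or.
move=> /and3P[n1 n2 n3]; apply/andP; split.
  apply: contra n2 => /eqP e; rewrite -st_le0 -e.
  exact: path_weight_le.
apply: contraT => lt.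
case/andP: og => _; apply: contraLR => _.
rewrite (@path_weight_cat _ _ a b d) ?(leq_trans bc) //.
rewrite (@path_weight_cat _ _ b c d) //.
rewrite (@range_prod_cat _ a b d) ?(leq_trans bc) //.
rewrite (@range_prod_cat _ b c d) //.
have nz (x y : S) : x != 0 -> x ≼ y -> y != 0.
  by move=> x0; apply: contraL => /eqP ->; rewrite st_le0.
apply: st_lt_le_trans (mul_entry_le _ _ _ (g b) _).
apply: st_le_ltM; rewrite ?path_weight_le //; last first.
  by apply: nz n1 _; apply: path_weight_le.
apply: st_lt_le_trans (mul_entry_le _ _ _ (g c) _).
apply: st_lt_leM; rewrite ?path_weight_le //.
by apply: nz n3 _; apply: path_weight_le.
Qed.

(** The path is advanced, or delayed, by p on a window.  At the ends of the
    window this removes a closed walk of length p and doubles another. *)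
Definition shiftl x0 y0 p g t := if (x0 <= t <= y0)%N then g (t + p)%N else g t.
Definition shiftr x0 y0 p g t :=
  if (x0 + p <= t <= y0 + p)%N then g (t - p)%N else g t.

Section Shift.
Variables (W : nat -> 'M[S]_n) (a b x0 y0 p : nat) (g : nat -> 'I_n).
Hypotheses (ax : (a <= x0)%N) (xy : (x0 + p <= y0)%N) (yb : (y0 + p <= b)%N).
Hypotheses (gx : g (x0 + p) = g x0) (gy : g (y0 + p) = g y0).
Hypothesis per : forall t, (x0 <= t < y0)%N -> W (t + p)%N = W t.

Lemma path_weight_shiftl : path_weight W (shiftl x0 y0 p g) a b =
  path_weight W g a x0 * path_weight W g (x0 + p) (y0 + p) * path_weight W g y0 b.
Proof.
rewrite (@path_weight_cat _ _ a x0 b) //; last by lia.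
rewrite (@path_weight_cat _ _ x0 y0 b) //; try lia.
rewrite mulrA; congr (_ * _ * _).
- apply: eq_big_nat => t /andP[_ tx]; rewrite /shiftl.
  have -> : (x0 <= t)%N = false by lia.
  case: ifP => // /andP[h _]; have -> : t.+1 = x0 by lia.
  by rewrite gx.
- rewrite /path_weight big_addn addnK.
  apply: eq_big_nat => t /andP[xt ty]; rewrite /shiftl.
  by rewrite xt (ltnW ty) (leqW xt) ty /= per ?xt // addSn.
- apply: eq_big_nat => t /andP[yt tb]; rewrite /shiftl.
  have -> : (t.+1 <= y0)%N = false by lia.
  rewrite andbF; case: ifP => // h; have -> : t = y0 by lia.
  by rewrite gy.
Qed.

Lemma path_weight_shiftr : path_weight W (shiftr x0 y0 p g) a b =
  path_weight W g a (x0 + p) * path_weight W g x0 y0 * path_weight W g (y0 + p) b.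
Proof.
rewrite (@path_weight_cat _ _ a (x0 + p) b) //; try lia.
rewrite (@path_weight_cat _ _ (x0 + p) (y0 + p) b) //; try lia.
rewrite mulrA; congr (_ * _ * _).
- apply: eq_big_nat => t /andP[_ tx]; rewrite /shiftr.
  have -> : (x0 + p <= t)%N = false by lia.
  case: ifP => // /andP[h _]; have -> : t.+1 = (x0 + p)%N by lia.
  by rewrite addnK gx.
- rewrite /path_weight big_addn addnK.
  apply: eq_big_nat => t /andP[xt ty]; rewrite /shiftr -addSn.
  by rewrite !leq_add2r xt (ltnW ty) (leqW xt) ty /= per ?xt // !addnK.
- apply: eq_big_nat => t /andP[yt tb]; rewrite /shiftr.
  have -> : (t.+1 <= y0 + p)%N = false by lia.
  rewrite andbF; case: ifP => // h; have -> : t = (y0 + p)%N by lia.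
  by rewrite addnK gy.
Qed.

(** The closed walk removed by one shift is the one doubled by the other. *)
Lemma path_weight_shift : path_weight W (shiftl x0 y0 p g) a b *
  path_weight W (shiftr x0 y0 p g) a b = path_weight W g a b * path_weight W g a b.
Proof.
rewrite path_weight_shiftl path_weight_shiftr.
rewrite (@path_weight_cat _ _ a x0 b) //; try lia.
rewrite (@path_weight_cat _ _ x0 (x0 + p) b) //; try lia.
rewrite (@path_weight_cat _ _ (x0 + p) y0 b) //; try lia.
rewrite (@path_weight_cat _ _ y0 (y0 + p) b) //; try lia.
rewrite (@path_weight_cat _ _ a x0 (x0 + p)) //; try lia.
rewrite (@path_weight_cat _ _ x0 (x0 + p) y0) //; try lia.
rewrite (@path_weight_cat _ _ (x0 + p) y0 (y0 + p)) //; try lia.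
ring.
Qed.

Lemma shift_ends : [/\ shiftl x0 y0 p g a = g a, shiftl x0 y0 p g b = g b,
  shiftr x0 y0 p g a = g a & shiftr x0 y0 p g b = g b].
Proof.
rewrite /shiftl /shiftr; split; case: ifP => // h.
- by have -> : a = x0 by lia.
- have -> : b = y0 by lia.
  by rewrite gy.
- have -> : a = (x0 + p)%N by lia.
  by rewrite addnK gx.
- have -> : b = (y0 + p)%N by lia.
  by rewrite addnK gy.
Qed.

(** Two weights that do not exceed the optimum and whose mean is the optimum are
    both optimal. *)
Lemma optimal_shift : optimal W a b g ->
  optimal W a b (shiftl x0 y0 p g) /\ optimal W a b (shiftr x0 y0 p g).
Proof.
move=> og; have [la lb ra rb] := shift_ends.
have ab : (a <= b)%N by lia.
have h0 := optimal_neq0 ab og; case/andP: og => r0 rg.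
rewrite /optimal la lb ra rb r0 /=.
have hl := path_weight_le W (shiftl x0 y0 p g) ab.
have hr := path_weight_le W (shiftr x0 y0 p g) ab.
rewrite la lb in hl; rewrite ra rb in hr.
have hl' := st_le_trans hl rg; have hr' := st_le_trans hr rg.
have e := path_weight_shift.
split; apply: contraT => lt.
- have : path_weight W g a b * path_weight W g a b ≺
    path_weight W g a b * path_weight W g a b; last by rewrite st_le_refl.
  rewrite -{2}e; apply: st_lt_leM => //.
  by apply: st_lt_le_trans lt rg.
- have : path_weight W g a b * path_weight W g a b ≺
    path_weight W g a b * path_weight W g a b; last by rewrite st_le_refl.
  rewrite -{2}e; apply: st_le_ltM => //.
  by apply: st_lt_le_trans lt rg.
Qed.

End Shift.
End Paths.

(** * Recurrence of unavoidable nodes *)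

Lemma pigeonhole (T : finType) (c : nat -> T) :
  exists i j, [/\ (i < j)%N, (j <= #|T|)%N & c i = c j].
Proof.
have /injectivePn[i [j ij cij]] : ~~ injectiveb (fun i : 'I_#|T|.+1 => c i).
  by apply/negP => /injectiveP /leq_card; rewrite card_ord ltnn.
have le (k : 'I_#|T|.+1) : (k <= #|T|)%N by rewrite -ltnS.
case: (ltngtP i j) => [lt|lt|/val_inj e]; last by rewrite e eqxx in ij.
  by exists i, j.
by exists j, i.
Qed.

Section Recurrence.
Variable R : realDomainType.
Local Notation S := (supertrop R).

Section Returns.
Variables (n : nat) (A : 'M[S]_n) (s : 'I_n) (T : nat) (g : nat -> 'I_n).
Let W (_ : nat) := A.
Hypothesis og : optimal W 0 (T + T) g.
Hypothesis through : forall h, h 0%N = g 0%N -> h (T + T)%N = g (T + T)%N ->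
  optimal W 0 (T + T) h -> h T = s.

(** Both shifts of g are optimal, hence at s at time T. *)
Lemma return_diff r r' : (r < r')%N -> (r' <= T)%N ->
  g (T - r)%N = g (T - r')%N -> g (T + r)%N = g (T + r')%N ->
  g (T - (r' - r))%N = s /\ g (T + (r' - r))%N = s.
Proof.
move=> rr' r'T el er.
pose x0 := (T - r')%N; pose y0 := (T + r)%N; pose p := (r' - r)%N.
have xp : (x0 + p = T - r)%N by rewrite /x0 /p; lia.
have yp : (y0 + p = T + r')%N by rewrite /y0 /p; lia.
have h1 : (0 <= x0)%N by [].
have h2 : (x0 + p <= y0)%N by rewrite xp /y0; lia.
have h3 : (y0 + p <= T + T)%N by rewrite yp; lia.
have gx : g (x0 + p)%N = g x0 by rewrite xp.
have gy : g (y0 + p)%N = g y0 by rewrite yp.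
have per t : (x0 <= t < y0)%N -> W (t + p)%N = W t by [].
have [ol or_] := optimal_shift h1 h2 h3 gx gy per og.
have [la lb ra rb] := shift_ends h1 h2 h3 gx gy.
have := through la lb ol; have := through ra rb or_.
rewrite /shiftl /shiftr xp yp /x0 /y0.
by rewrite !leq_addr !leq_subr /=.
Qed.

Local Notation q := #|{: 'I_n * 'I_n}|.

(** The times r such that g is at s at both T - r and T + r are closed under
    difference.  By pigeonhole on the pairs of nodes at T - r and T + r, they
    contain a positive number d that is at most q and a number that is at
    least L.  So they contain all multiples of the least d up to L, among them
    the multiples of q!. *)
Lemma returns L k : (0 < L)%N -> T = (q * L)%N -> (k * q`! <= L)%N ->
  g (T - k * q`!)%N = s /\ g (T + k * q`!)%N = s.
Proof.
move=> L0 TE kL.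
have q0 : (0 < q)%N by apply/card_gt0P; exists (s, s).
pose Z r := [&& (r <= T)%N, g (T - r)%N == s & g (T + r)%N == s].
pose c r := (g (T - r)%N, g (T + r)%N).
have Z0 : Z 0%N.
  have e : g T = s by apply: through.
  by rewrite /Z subn0 addn0 e eqxx.
have Zdiff r r' : (r < r')%N -> (r' <= T)%N -> c r = c r' -> Z (r' - r)%N.
  move=> rr' r'T [el er]; have [e1 e2] := return_diff rr' r'T el er.
  by rewrite /Z e1 e2 eqxx andbT; lia.
have Zsub r r' : (r <= r')%N -> Z r -> Z r' -> Z (r' - r)%N.
  rewrite leq_eqVlt => /orP[/eqP ->|rr']; first by rewrite subnn.
  move=> /and3P[_ /eqP e1 /eqP e2] /and3P[r'T /eqP e3 /eqP e4].
  by apply: Zdiff; rewrite // /c e1 e2 e3 e4.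
have ex : exists d, (0 < d <= q)%N && Z d.
  have [i [j [ij jq cij]]] := pigeonhole c.
  exists (j - i)%N; rewrite subn_gt0 ij (leq_trans (leq_subr _ _) jq).
  by apply: Zdiff => //; rewrite TE; apply: leq_trans jq _; rewrite leq_pmulr.
(* Times spaced by L: a repetition among them has a difference of at least L. *)
have [r Lr Zr] : exists2 r, (L <= r)%N & Z r.
  have [i [j [ij jq cij]]] := pigeonhole (fun r => c (r * L)%N).
  exists (j * L - i * L)%N; first by rewrite -mulnBl leq_pmull // subn_gt0.
  by apply: Zdiff; rewrite // ?ltn_pmul2r // TE leq_pmul2r.
case: (ex_minnP ex) => d /andP[/andP[d0 dq] Zd] dmin.
have dvd r' : Z r' -> (d %| r')%N.
  elim/ltn_ind: r' => r' IH Zr'; case: (ltnP r' d) => [lt|le].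
    case: (posnP r') => [->|r'0]; first exact: dvdn0.
    have := dmin r'; rewrite r'0 Zr' (leq_trans (ltnW lt) dq) => /(_ isT).
    by rewrite leqNgt lt.
  by rewrite -(subnK le) dvdn_addl // IH ?Zsub // ltn_subrL d0 (leq_trans d0 le).
have mult m : (m * d <= r)%N -> Z (r - m * d)%N.
  elim: m => [|m IH] h; first by rewrite subn0.
  have -> : (r - m.+1 * d = r - m * d - d)%N by rewrite mulSn -subnDA addnC.
  by apply: Zsub => //; [|apply: IH]; lia.
have /dvdnP[m Em] : (d %| r - k * q`!)%N.
  by apply: dvdn_sub; [apply: dvd|apply/dvdn_mull/dvdn_fact; rewrite d0].
have := mult m; rewrite -Em subKn ?(leq_trans kL) //.
by rewrite leq_subr => /(_ isT) /and3P[_ /eqP-> /eqP->].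
Qed.
End Returns.

Section Dominance.
Variables (n : nat) (A : 'M[S]_n.+1) (L T : nat).
Local Notation q := #|{: 'I_n.+1 * 'I_n.+1}|.
Let W (_ : nat) := A.

Lemma range_prod_const a b : range_prod W a b = A ^+ (b - a).
Proof. by rewrite /range_prod prodr_const_nat. Qed.

Lemma path_weight_steps s g N m a :
  (forall j, (j <= m)%N -> g (a + j * N)%N = s) ->
  path_weight W g a (a + m * N) ≼ ((A ^+ N) s s) ^+ m.
Proof.
elim: m => [|m IH] h.
  by rewrite mul0n addn0 /path_weight big_geq // expr0 st_le_refl.
rewrite (@path_weight_cat _ _ _ _ a (a + m * N)); try lia.
rewrite exprSr; apply: st_leM; first by apply: IH => j jm; apply/h/leqW.
apply: st_le_trans (path_weight_le _ _ _) _; first lia.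
rewrite range_prod_const !h //.
by rewrite (_ : (a + m.+1 * N - (a + m * N) = N)%N) ?st_le_refl //; lia.
Qed.

(** A closed walk at s through x that is as good as the loops at s could replace
    the segment of the forced optimal walk around time T, which would then
    avoid s at time T. *)
Lemma unavoidable_dominance s :
  (0 < L)%N -> (q`! <= L)%N -> T = (q * L)%N -> ~~ avoidable s (A ^+ T) (A ^+ T) ->
  (A ^+ q`!) s s != 0 /\
  forall k k' x, (k * q`! <= L)%N -> (k' * q`! <= L)%N -> x != s ->
    (A ^+ q`! ^+ k) s x * (A ^+ q`! ^+ k') x s ≺ ((A ^+ q`!) s s) ^+ (k + k').
Proof.
set N := q`!; move=> L0 NL TE.
rewrite negb_forall => /existsP[i]; rewrite negb_forall => /existsP[j].
have AT : A ^+ T * A ^+ T = range_prod W 0 (T + T) by rewrite range_prod_const subn0 exprD.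
rewrite AT => lt.
have av x : x != s -> (A ^+ T) i x * (A ^+ T) x j ≼ avoid s (A ^+ T) (A ^+ T) i j.
  rewrite eq_sym => /unlift_some[x' -> _].
  rewrite [avoid _ _ _ _ _]mxE.
  apply: st_le_trans (@st_le_sum _ _ xpredT _ x' isT).
  by rewrite !mxE st_le_refl.
have [g [g0 gT hg]] := path_attained (leq0n _) (st_lt_neq0 lt).
have og : optimal W 0 (T + T) g by rewrite /optimal g0 gT hg (st_lt_neq0 lt).
have through h : h 0%N = g 0%N -> h (T + T)%N = g (T + T)%N ->
    optimal W 0 (T + T) h -> h T = s.
  rewrite g0 gT => h0 hT /andP[_]; rewrite h0 hT => oh; apply/eqP.
  apply: contraT => /av le; move: lt; rewrite (st_le_trans oh) //.
  apply: st_le_trans le; rewrite (@path_weight_cat _ _ _ _ 0 T); try lia.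
  by apply: st_leM; apply: st_le_trans (path_weight_le _ _ _) _; try lia;
    rewrite range_prod_const ?h0 ?hT ?addnK ?subn0 st_le_refl.
have ret k : (k * N <= L)%N -> g (T - k * N)%N = s /\ g (T + k * N)%N = s.
  by move=> kL; have := returns og through L0 TE kL.
have LT : (L <= T)%N by rewrite TE leq_pmull //; apply/card_gt0P; exists (s, s).
have gTs : g T = s by have [] := ret 0%N isT; rewrite mul0n subn0.
split.
  have /optimal_neq0 : optimal W T (T + N) g.
    by apply: (@optimal_sub _ _ _ 0 _ _ (T + T)) => //; lia.
  rewrite leq_addr => /(_ isT); apply: contra => /eqP e.
  rewrite -st_le0 -{}e (st_le_trans (path_weight_le _ _ _)) ?leq_addr //.
  have [|_ h1] := ret 1%N; first by rewrite mul1n.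
  by rewrite mul1n in h1; rewrite range_prod_const addKn gTs h1 st_le_refl.
move=> k k' x kL k'L xs; have [ka _] := ret k kL; have [_ kb] := ret k' k'L.
apply: contraL lt => le; rewrite negbK.
pose a := (T - k * N)%N; pose b := (T + k' * N)%N.
apply: st_le_trans hg _; apply: st_le_trans (av x xs).
rewrite (@path_weight_cat _ _ _ _ 0 a); try lia.
rewrite (@path_weight_cat _ _ _ _ a b); try lia.
have ab : path_weight W g a b ≼ (A ^+ N ^+ k) s x * (A ^+ N ^+ k') x s.
  apply: st_le_trans le; have -> : b = (a + (k + k') * N)%N by rewrite /a /b; lia.
  apply: path_weight_steps => r rk.
  case: (leqP r k) => rk'.
    have [|<- _] := ret (k - r)%N; first by nia.
    by congr (g _); rewrite /a; nia.
  have [|_ <-] := ret (r - k)%N; first by nia.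
  by congr (g _); rewrite /a; nia.
have e1 : A ^+ T = A ^+ a * (A ^+ N ^+ k).
  by rewrite -exprM -exprD; congr (_ ^+ _); rewrite /a; lia.
have e2 : A ^+ T = (A ^+ N ^+ k') * A ^+ (T - k' * N).
  by rewrite -exprM -exprD; congr (_ ^+ _); lia.
rewrite {1}e1 e2.
apply: st_le_trans (st_leM (mul_entry_le _ _ _ s _) (mul_entry_le _ _ _ s _)).
rewrite -[X in st_le _ X]mulrA [X in st_le _ (_ * X)]mulrA.
apply: st_leM; last first.
  apply: st_leM => //; apply: st_le_trans (path_weight_le _ _ _) _; first by lia.
  by rewrite range_prod_const gT kb (_ : T + T - b = T - k' * N)%N ?st_le_refl //; lia.
apply: st_le_trans (path_weight_le _ _ _) _ => //.
by rewrite range_prod_const g0 ka subn0 st_le_refl.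
Qed.
End Dominance.
End Recurrence.

(** * No return to a node that was left *)

Section Diagonal.
Variable R : realDomainType.
Local Notation S := (supertrop R).

Lemma st_leX (x y : S) m : x ≼ y -> x ^+ m ≼ y ^+ m.
Proof.
move=> xy; elim: m => [|m IH]; first by rewrite !expr0 st_le_refl.
by rewrite !exprS st_leM.
Qed.

(** Iterating sg from s gives a closed walk of length #[sg], strictly worse than
    the loops at s unless sg fixes s.  The product over s of the weights of
    these walks is the #[sg]-th power of the weight of sg. *)
Lemma perm_dominance n (X : 'M[S]_n.+1) (K : nat) (sg : 'S_n.+1) :
  (n.+1`! <= K)%N -> (forall s, X s s != 0) ->
  (forall s k k' x, (k <= K)%N -> (k' <= K)%N -> x != s ->
    (X ^+ k) s x * (X ^+ k') x s ≺ (X s s) ^+ (k + k')) ->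
  sg != 1%g -> \prod_s X s (sg s) ≺ \prod_s X s s.
Proof.
move=> nK X0 dom sg1.
have [s0 sgs0] : exists s, sg s != s.
  apply/existsP; apply: contraT; rewrite negb_exists => /forallP h.
  case/eqP: sg1; apply/permP => s; rewrite perm1.
  by have := h s; rewrite negbK => /eqP.
set m := #[sg]%g.
have m0 : (0 < m)%N by apply: order_gt0.
have mK : (m <= K)%N.
  apply: leq_trans nK; rewrite /m /order -card_Sn.
  exact: max_card.
pose W (_ : nat) := X; pose g s t := (sg ^+ t)%g s.
have g0 s : g s 0%N = s by rewrite /g expg0 perm1.
have gm s : g s m = s by rewrite /g expg_order perm1.
have gS s t : g s t.+1 = sg (g s t) by rewrite /g expgSr permM.
have lt s : sg s != s -> path_weight W (g s) 0 m ≺ (X s s) ^+ m.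
  move=> sgs; rewrite (@path_weight_cat _ _ _ _ 0 1 m) //.
  have := dom s 1%N m.-1 (sg s); rewrite add1n prednK //; move=> /(_ _ _ sgs) h.
  apply: st_le_lt_trans (h _ _); try lia.
  apply: st_leM; apply: st_le_trans (path_weight_le _ _ _) _ => //.
    by rewrite range_prod_const gS g0 st_le_refl.
  by rewrite range_prod_const gS g0 gm subn1 st_le_refl.
have le s : path_weight W (g s) 0 m ≼ (X s s) ^+ m.
  case: (eqVneq (sg s) s) => [e|/lt /st_ltW //].
  rewrite -{2}(add0n m) -{1}(muln1 m); apply: (@path_weight_steps _ _ X s (g s) 1 m 0).
  move=> j _; rewrite muln1 add0n; elim: j => [|j IH]; first by rewrite g0.
  by rewrite gS IH.
have : \prod_s path_weight W (g s) 0 m ≺ \prod_s (X s s) ^+ m.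
  apply: (@st_ltM_prod _ _ _ _ s0) => //; first exact: lt.
  by move=> s; rewrite -[_ ^+ _]prodr_const; apply: st_prod_neq0.
rewrite prodrXl; apply: contra.
suff -> : \prod_s path_weight W (g s) 0 m = (\prod_s X s (sg s)) ^+ m.
  exact: st_leX.
rewrite exchange_big /= (eq_bigr (fun=> \prod_s X s (sg s))); last first.
  move=> t _; rewrite [RHS](reindex_inj (@perm_inj _ (sg ^+ t)%g)) /=.
  by apply: eq_bigr => s _; rewrite /W gS.
by rewrite prodr_const_nat subn0.
Qed.

Lemma eval_range n L (z0 : L) (Z : L -> 'M[S]_n) v :
  eval Z v = range_prod (fun t => Z (nth z0 v t)) 0 (size v).
Proof. by rewrite /eval (big_nth z0). Qed.

Lemma path_attained_via n (W : nat -> 'M[S]_n) a b c i k j :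
  (a <= b)%N -> (b <= c)%N ->
  range_prod W a b i k * range_prod W b c k j != 0 ->
  exists g, [/\ g a = i, g b = k, g c = j &
    range_prod W a b i k * range_prod W b c k j ≼ path_weight W g a c].
Proof.
move=> ab bc; rewrite st_mul_eq0 negb_or => /andP[h1 h2].
have [g1 [a1 b1 l1]] := path_attained ab h1.
have [g2 [b2 c2 l2]] := path_attained bc h2.
exists (fun t => if (t < b)%N then g1 t else g2 t).
rewrite ltnn (ltnNge c) bc /=; split=> //.
  by case: ltnP => // h; have e : a = b by [lia]; rewrite -a1 e b1 -b2.
rewrite (@path_weight_cat _ _ _ _ a b c) //; apply: st_leM.
  rewrite -(@eq_path_weight _ _ _ g1) // => t /andP[_ tb].
  by case: ltnP => // h; have -> : t = b by [lia]; rewrite b1 b2.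
rewrite -(@eq_path_weight _ _ _ g2) // => t /andP[bt _].
by rewrite ltnNge bt.
Qed.

Section Word.
Variables (n : nat) (Z : bool -> 'M[S]_n.+1) (v : seq bool).
Hypothesis diag0 : forall z s, Z z s s != 0.
Hypothesis permdom : forall z (sg : 'S_n.+1), sg != 1%g ->
  \prod_s Z z s (sg s) ≺ \prod_s Z z s s.
Let B := eval Z v.
Hypothesis B0 : forall s, B s s != 0.
Hypothesis dom2 : forall s x, x != s -> B s x * B x s ≺ (B s s) ^+ 2.
Let W t := Z (nth true v t).
Let l := size v.

Let BE : B = range_prod W 0 l. Proof. exact: eval_range. Qed.

Definition diag_weight s : S := \prod_(z <- v) Z z s s.

Lemma diag_weight_path s : diag_weight s = path_weight W (fun=> s) 0 l.
Proof. by rewrite /diag_weight (big_nth true). Qed.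

Lemma diag_weight_le s : diag_weight s ≼ B s s.
Proof. by rewrite BE diag_weight_path; apply: path_weight_le. Qed.

(** Take an optimal closed walk at each node.  Two of them never meet: exchanging
    their ends would give a closed walk from one of the nodes through the other
    one that [dom2] excludes.  So at each time the n walks perform a
    permutation, and together they weigh strictly less than all the loops
    unless each of these permutations is the identity. *)
Lemma orbits_constant (h : 'I_n.+1 -> nat -> 'I_n.+1) :
  (forall s, h s 0%N = s) -> (forall s, h s l = s) ->
  (forall s, B s s ≼ path_weight W (h s) 0 l) ->
  forall t s, (t <= l)%N -> h s t = s.
Proof.
move=> h0 hl ho.
have inj t : (t <= l)%N -> injective (fun s => h s t).
  move=> tl s1 s2 e; apply/eqP; apply: contraT => ne.
  have half s s' : h s t = h s' t ->
      path_weight W (h s) 0 t * path_weight W (h s') t l ≼ B s s'.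
    move=> e'; rewrite BE (@range_prod_cat _ _ _ _ t) //.
    apply: st_le_trans (mul_entry_le _ _ _ (h s t) _); apply: st_leM.
      by have := path_weight_le W (h s) (leq0n t); rewrite h0.
    by have := path_weight_le W (h s') tl; rewrite e' hl.
  have cross : B s1 s1 * B s2 s2 ≼ B s1 s2 * B s2 s1.
    apply: st_le_trans (st_leM (ho s1) (ho s2)) _.
    rewrite !(@path_weight_cat _ _ _ _ 0 t l) //.
    apply: st_le_trans (st_leM (half _ _ e) (half _ _ (esym e))).
    by rewrite mulrACA [X in _ * X]mulrC mulrACA st_le_refl.
  have lt1 := st_le_lt_trans cross (dom2 (introN eqP (fun x => negP ne (introT eqP (esym x))))).
  have lt2 : B s1 s1 * B s2 s2 ≺ B s2 s2 ^+ 2.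
    by apply: st_le_lt_trans cross _; rewrite mulrC; apply: dom2.
  case/orP: (st_le_total (B s1 s1) (B s2 s2)) => le.
    by move: lt1; rewrite expr2 st_leM // st_le_refl.
  by move: lt2; rewrite expr2 st_leM // st_le_refl.
pose f (t : nat) : 'S_n.+1 :=
  if (t <= l)%N =P true is ReflectT tl then perm (inj t tl) else 1%g.
have fE t s : (t <= l)%N -> f t s = h s t.
  by move=> tl; rewrite /f; case: eqP => // tl'; rewrite permE.
pose sg t := ((f t)^-1 * f t.+1)%g.
have stepE t : (t < l)%N -> \prod_s W t (h s t) (h s t.+1) = \prod_s W t s (sg t s).
  move=> tl; rewrite [RHS](reindex_inj (@perm_inj _ (f t))) /=.
  apply: eq_bigr => s _; rewrite /sg permM permK !fE //; exact: ltnW.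
have step t : (t < l)%N -> \prod_s W t (h s t) (h s t.+1) ≼ \prod_s W t s s.
  move=> tl; rewrite stepE //; case: (eqVneq (sg t) 1%g) => [->|ne].
    by under eq_bigr do rewrite perm1; exact: st_le_refl.
  by apply/st_ltW/permdom.
have allid t : (t < l)%N -> sg t = 1%g.
  move=> tl; apply/eqP; apply: contraT => ne.
  have : \prod_s B s s ≺ \prod_s B s s; last by rewrite st_le_refl.
  apply: (@st_le_lt_trans _ (\prod_s path_weight W (h s) 0 l)).
    by apply: st_leM_prod.
  apply: (@st_lt_le_trans _ (\prod_s diag_weight s)); last first.
    by apply: st_leM_prod => s _; apply: diag_weight_le.
  have -> : \prod_s diag_weight s = \prod_(t < l) \prod_s W t s s.
    rewrite [RHS]exchange_big; apply: eq_bigr => s _.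
    by rewrite diag_weight_path /path_weight big_mkord.
  have -> : \prod_s path_weight W (h s) 0 l =
      \prod_(t < l) \prod_s W t (h s t) (h s t.+1).
    by rewrite [RHS]exchange_big; apply: eq_bigr => s _; rewrite /path_weight big_mkord.
  apply: (@st_ltM_prod _ _ _ _ (Ordinal tl)).
  - by move=> i; apply: step; apply: ltn_ord.
  - by rewrite stepE //=; apply: permdom.
  - by move=> i; apply: st_prod_neq0 => s _; apply: diag0.
elim=> [|t IH] s tl; first exact: h0.
have := allid t tl; rewrite /sg => /(canRL (mulKVg _)); rewrite mulg1 => e.
by rewrite -fE // e fE ?IH // ltnW.
Qed.

(** By the preceding lemma the loops at s are themselves optimal, so g is one of
    the optimal closed walks to which that lemma applies. *)
Lemma closed_path_constant s g : g 0%N = s -> g l = s ->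
  diag_weight s ≼ path_weight W g 0 l -> forall t, (t <= l)%N -> g t = s.
Proof.
move=> g0 gl hg t tl.
have [h hP] : exists h : 'I_n.+1 -> nat -> 'I_n.+1, forall s,
    [/\ h s 0%N = s, h s l = s & B s s ≼ path_weight W (h s) 0 l].
  apply: (@fin_all_exists _ (fun=> nat -> 'I_n.+1) (fun y h =>
    [/\ h 0%N = y, h l = y & B y y ≼ path_weight W h 0 l])) => y.
  by rewrite BE; apply: path_attained; rewrite // -BE.
pose h' y := if y == s then g else h y.
have Bs : B s s ≼ path_weight W g 0 l.
  apply: st_le_trans hg.
  have [_ _ hs] := hP s; apply: st_le_trans hs _.
  rewrite diag_weight_path -(@eq_path_weight _ _ _ (h s)) ?st_le_refl //.
  by move=> r /andP[_ rl]; apply: (@orbits_constant h) => // y; case: (hP y).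
have := @orbits_constant h' _ _ _ t s tl; rewrite /h' eqxx; apply=> y;
  by case: eqP => [->|_] //; case: (hP y).
Qed.

Lemma no_return p r s x : v = p ++ r -> x != s ->
  eval Z p s x * eval Z r x s ≺ diag_weight s.
Proof.
move=> vE xs; apply: contraNN xs => le.
have d0 : diag_weight s != 0 by apply: st_prod_neq0.
have pl : (size p <= l)%N by rewrite /l vE size_cat leq_addr.
have pE : eval Z p = range_prod W 0 (size p).
  rewrite (eval_range true); apply: eq_big_nat => t /andP[_ tp].
  by rewrite /W vE nth_cat tp.
have rE : eval Z r = range_prod W (size p) l.
  rewrite (eval_range true) /range_prod -{1}(add0n (size p)) big_addn.
  rewrite /l vE size_cat addKn; apply: eq_big_nat => t _.
  by rewrite /W vE nth_cat ltnNge leq_addl addnK.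
rewrite pE rE in le.
have n0 : range_prod W 0 (size p) s x * range_prod W (size p) l x s != 0.
  by apply: contra d0 => /eqP e; move: le; rewrite e st_le0.
have [g [g0 gp gl hg]] := path_attained_via (leq0n _) pl n0.
have := closed_path_constant g0 gl (st_le_trans le hg) pl.
by rewrite gp => ->.
Qed.
End Word.
End Diagonal.

(** * Exchanging the central letter *)

Section Centre.
Variable R : realDomainType.
Local Notation S := (supertrop R).
Variables (n : nat) (W : nat -> 'M[S]_n) (l c p : nat).
Local Notation q := #|{: 'I_n * 'I_n}|.
Hypothesis noret : forall a b d s x, (a <= b)%N -> (b <= d)%N -> (d <= l)%N ->
  x != s -> range_prod W a b s x * range_prod W b d x s ≺ range_prod W a d s s.
Hypotheses (p0 : (0 < p)%N) (radl : (p * 4 ^ q <= c)%N)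
  (radr : (c.+1 + p * 4 ^ q <= l)%N).
Hypothesis per : forall t, (c - p * 4 ^ q <= t)%N ->
  (t + p < c.+1 + p * 4 ^ q)%N -> W (t + p)%N = W t.

Lemma optimal_contiguous g a b d : optimal W 0 l g ->
  (a <= b)%N -> (b <= d)%N -> (d <= l)%N -> g a = g d -> g b = g a.
Proof.
move=> og ab bd dl e; apply/eqP; apply: contraT => ne.
have /andP[_ h] := optimal_sub (leq0n _) (leq_trans ab bd) dl og.
move: h; apply: contraLR => _; rewrite (@path_weight_cat _ _ _ _ a b d) //.
rewrite -e; apply: st_le_lt_trans (noret ab bd dl ne).
apply: st_leM; first exact: path_weight_le.
by have := path_weight_le W g bd; rewrite -e.
Qed.

Lemma periodic_mul k t : (c - p * 4 ^ q <= t)%N ->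
  (t + k * p < c.+1 + p * 4 ^ q)%N -> W (t + k * p)%N = W t.
Proof.
elim: k => [|k IH] tl tr; first by rewrite mul0n addn0.
have e : (t + k.+1 * p = t + k * p + p)%N by rewrite mulSn addnCA addnC.
by rewrite e in tr *; rewrite per ?IH //; lia.
Qed.

(** By pigeonhole there are radii u < u' around the centre such that g repeats
    its node between c - u' and c - u, and between c + 1 + u and c + 1 + u'.
    As g returns to no node, it is constant on these two zones.  The radii grow
    geometrically, so each zone is longer than the part in between, and shifting
    by u' - u brings one zone or the other over the centre. *)
Lemma centre_jump_tie g : optimal W 0 l g -> g c != g c.+1 ->
  exists g1 g2, [/\ optimal W 0 l g1 /\ optimal W 0 l g2,
    g1 0%N = g 0%N /\ g1 l = g l, g2 0%N = g 0%N /\ g2 l = g l,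
    g1 c = g1 c.+1 /\ g2 c = g2 c.+1 & g1 c != g2 c].
Proof.
move=> og jump.
have [k [k' [kk' k'q [el er]]]] :=
  pigeonhole (fun k => (g (c - p * 4 ^ k)%N, g (c.+1 + p * 4 ^ k)%N)).
pose u := (p * 4 ^ k)%N; pose u' := (p * 4 ^ k')%N; pose r := (p * 4 ^ q)%N.
have uu' : (4 * u <= u')%N.
  by rewrite /u /u' mulnCA -expnS leq_pmul2l // leq_exp2l.
have u'r : (u' <= r)%N by rewrite leq_pmul2l // leq_exp2l.
have u0 : (0 < u)%N by rewrite muln_gt0 p0 expn_gt0.
have rc : (r <= c)%N := radl; have rl : (c.+1 + r <= l)%N := radr.
rewrite -/u -/u' in el er.
pose x0 := (c - u')%N; pose y0 := (c.+1 + u)%N; pose s := (u' - u)%N.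
have xs : (x0 + s = c - u)%N by rewrite /x0 /s; lia.
have ys : (y0 + s = c.+1 + u')%N by rewrite /y0 /s; lia.
have h1 : (0 <= x0)%N by [].
have h2 : (x0 + s <= y0)%N by rewrite xs /y0; lia.
have h3 : (y0 + s <= l)%N by rewrite ys; lia.
have gx : g (x0 + s)%N = g x0 by rewrite xs el.
have gy : g (y0 + s)%N = g y0 by rewrite ys er.
have per' t : (x0 <= t < y0)%N -> W (t + s)%N = W t.
  move=> /andP[xt ty]; have -> : s = ((4 ^ k' - 4 ^ k) * p)%N.
    by rewrite mulnBl mulnC [(4 ^ k * p)%N]mulnC.
  apply: periodic_mul; first by rewrite -/r; move: xt; rewrite /x0; lia.
  rewrite mulnBl mulnC [(4 ^ k * p)%N]mulnC -/u -/u' -/r.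
  by move: ty; rewrite /y0; lia.
have [ol or_] := optimal_shift h1 h2 h3 gx gy per' og.
have [la lb ra rb] := shift_ends h1 h2 h3 gx gy.
have right t : (y0 <= t)%N -> (t <= y0 + s)%N -> g t = g y0.
  by move=> yt ty; apply: (optimal_contiguous og yt ty); rewrite ?gy.
have left t : (x0 <= t)%N -> (t <= x0 + s)%N -> g t = g x0.
  by move=> yt ty; apply: (optimal_contiguous og yt ty); rewrite ?gx //; lia.
have l1 : shiftl x0 y0 s g c = g y0.
  rewrite /shiftl ifT; first by apply: right; rewrite /y0 /s; lia.
  by rewrite /x0 /y0; lia.
have l2 : shiftl x0 y0 s g c.+1 = g y0.
  rewrite /shiftl ifT; first by apply: right; rewrite /y0 /s; lia.
  by rewrite /x0 /y0; lia.
have r1 : shiftr x0 y0 s g c = g x0.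
  rewrite /shiftr ifT; first by apply: left; rewrite /x0 /s; lia.
  by rewrite xs ys; lia.
have r2 : shiftr x0 y0 s g c.+1 = g x0.
  rewrite /shiftr ifT; first by apply: left; rewrite /x0 /s; lia.
  by rewrite xs ys; lia.
exists (shiftl x0 y0 s g), (shiftr x0 y0 s g); split=> //.
  by rewrite l1 l2 r1 r2.
rewrite l1 r1; apply: contra jump => /eqP e.
have gxy : g x0 = g y0 by rewrite e.
have le1 : (y0 <= l)%N by lia.
have i1 : (x0 <= c)%N by rewrite /x0; lia.
have i2 : (c <= y0)%N by rewrite /y0; lia.
rewrite (optimal_contiguous og i1 i2 le1 gxy).
have i3 : (x0 <= c.+1)%N by rewrite /x0; lia.
have i4 : (c.+1 <= y0)%N by rewrite /y0; lia.
by rewrite (optimal_contiguous og i3 i4 le1 gxy).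
Qed.

(** The terms that change node at the centre never exceed the others, and when
    they reach the same value this value is already reached twice. *)
Lemma centre_diagonal i j : range_prod W 0 l i j =
  \sum_s range_prod W 0 c i s * W c s s * range_prod W c.+1 l s j.
Proof.
have cl : (c.+1 <= l)%N := leq_trans (leq_addr _ _) radr.
have cl' := ltnW cl.
set P := range_prod W 0 c; set Q := range_prod W c.+1 l.
pose F s := P i s * W c s s * Q s j.
pose G s s' := P i s * W c s s' * Q s' j.
pose y := \sum_s \sum_(s' | s' != s) G s s'.
have tot : range_prod W 0 l i j = \sum_s F s + y.
  rewrite (@range_prod_cat _ _ _ 0 c l) //.
  rewrite (@range_prod_cat _ _ _ c c.+1 l) // -/P -/Q.
  have -> : range_prod W c c.+1 = W c by rewrite /range_prod big_nat1.
  rewrite mxE /y -big_split; apply: eq_bigr => s _.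
  rewrite mxE big_distrr /= (bigD1 s) //= mulrA; congr (_ + _).
  by apply: eq_bigr => s' _; rewrite mulrA.
rewrite -/(F _) tot.
have -> : \sum_s P i s * W c s s * Q s j = \sum_s F s by [].
case/boolP: (\sum_s F s ≼ y) => [xy|]; last exact: st_lt_add_absorb.
case: (eqVneq y 0) => [->|y0]; first by rewrite addr0.
have [s _ ys] := st_sum_attained y0 (st_le_refl y).
have [s' ss' yG] := st_sum_attained y0 ys.
have G0 : G s s' != 0 by apply: contra y0 => /eqP e; rewrite -st_le0 -e.
have totG : range_prod W 0 l i j ≼ G s s'.
  by rewrite tot st_leD yG (st_le_trans xy).
move: (G0); rewrite /G !st_mul_eq0 !negb_or -andbA => /and3P[P0 _ Q0].
have [g1 [a1 b1 w1]] := path_attained (leq0n c) P0.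
have [g2 [a2 b2 w2]] := path_attained cl Q0.
pose g t := if (t <= c)%N then g1 t else g2 t.
have gG : G s s' ≼ path_weight W g 0 l.
  rewrite (@path_weight_cat _ _ _ _ 0 c l) //.
  rewrite (@path_weight_cat _ _ _ _ c c.+1 l) //.
  rewrite /G -mulrA; apply: st_leM.
    rewrite -(@eq_path_weight _ _ _ g1) // => t /andP[_ tc].
    by rewrite /g tc.
  apply: st_leM.
    by rewrite /path_weight big_nat1 /g leqnn ltnn b1 a2 st_le_refl.
  rewrite -(@eq_path_weight _ _ _ g2) // => t /andP[ct _].
  by rewrite /g leqNgt ct.
have g0 : g 0%N = i by rewrite /g leq0n.
have gl : g l = j by rewrite /g leqNgt cl.
have og : optimal W 0 l g.
  rewrite /optimal g0 gl (st_le_trans totG gG) andbT.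
  have lel := path_weight_le W g (leq0n l); rewrite g0 gl in lel.
  apply: contra G0 => /eqP e.
  by rewrite -st_le0 -e (st_le_trans gG).
have jump : g c != g c.+1 by rewrite /g leqnn ltnn b1 a2 eq_sym.
have [h1 [h2 [[o1 o2] [h10 h1l] [h20 h2l] [c1 c2] ne]]] := centre_jump_tie og jump.
have toF h : h 0%N = g 0%N -> h l = g l -> optimal W 0 l h -> h c = h c.+1 ->
    range_prod W 0 l i j ≼ F (h c).
  rewrite g0 gl => e0 el /andP[_]; rewrite e0 el => oh ec.
  apply: st_le_trans oh _.
  rewrite (@path_weight_cat _ _ _ _ 0 c l) //.
  rewrite (@path_weight_cat _ _ _ _ c c.+1 l) //.
  rewrite /F -mulrA; apply: st_leM.
    by have := path_weight_le W h (leq0n c); rewrite e0.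
  apply: st_leM; first by rewrite /path_weight big_nat1 -ec st_le_refl.
  by have := path_weight_le W h cl; rewrite el -ec.
have t1 := toF _ h10 h1l o1 c1; have t2 := toF _ h20 h2l o2 c2.
have Fx s1 : F s1 ≼ \sum_s F s by apply: (@st_le_sum _ _ xpredT).
have xt : \sum_s F s ≼ range_prod W 0 l i j by rewrite tot st_le_addE st_le_refl.
apply: ghost_add_absorb.
  apply: (@ghost_sum _ _ F _ _ ne) => [k|].
    exact: st_le_trans (Fx k) (st_le_trans xt t1).
  exact: st_le_trans (Fx _) (st_le_trans xt t2).
apply: st_le_trans (Fx (h1 c)); apply: st_le_trans t1.
by rewrite tot st_le_addE st_le_refl orbT.
Qed.
End Centre.

(** * Combining identities *)

Section Combination.
Variable R : realDomainType.
Local Notation S := (supertrop R).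

Lemma eval_nseq n (L : Type) (M : L -> 'M[S]_n) k z : eval M (nseq k z) = M z ^+ k.
Proof.
elim: k => [|k IH]; first by rewrite expr0 /eval big_nil.
by rewrite /= eval_cons IH exprS.
Qed.

Lemma eval_flatten_nseq n (L : Type) (M : L -> 'M[S]_n) k w :
  eval M (flatten (nseq k w)) = eval M w ^+ k.
Proof.
elim: k => [|k IH]; first by rewrite expr0 /eval big_nil.
by rewrite /= eval_cat IH exprS.
Qed.

Lemma eval_padded n (M : bool -> 'M[S]_n) r x y u : eval M x = eval M y ->
  eval M (padded r x y u) = (eval M r * eval M x) ^+ size u * eval M r.
Proof.
move=> e; rewrite /padded eval_cat eval_subst; congr (_ * _).
elim: u => [|z u IH]; first by rewrite expr0 /eval big_nil.
by rewrite eval_cons IH /= exprS eval_cat; case: z; rewrite ?e.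
Qed.

End Combination.

Lemma size_subst_const (L L' : Type) (f : L -> seq L') k w :
  (forall z, size (f z) = k) -> size (subst f w) = (k * size w)%N.
Proof.
move=> h; rewrite /subst; elim: w => [|z w IH] /=; first by rewrite muln0.
by rewrite size_cat h IH mulnS.
Qed.

Lemma size_padded r x y u : size x = size y ->
  size (padded r x y u) = ((size r + size x) * size u + size r)%N.
Proof.
move=> e; rewrite /padded size_cat (@size_subst_const _ _ _ (size r + size x)) //.
by case; rewrite size_cat ?e.
Qed.

Lemma padded_inj r x y u v : size x = size y -> x <> y -> size u = size v ->
  padded r x y u = padded r x y v -> u = v.
Proof.
move=> sxy nxy suv /eqP.
have ss w : size (subst (fun z => r ++ if z then x else y) w) =
    ((size r + size x) * size w)%N.
  by apply: size_subst_const; case; rewrite size_cat ?sxy.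
rewrite /padded eqseq_cat; last by rewrite !ss suv.
case/andP=> /eqP + _.
elim: u v suv {ss} => [|a u IH] [|b v] //= [suv]; rewrite /subst /= => /eqP.
rewrite eqseq_cat; last by case: a; case: b; rewrite !size_cat ?sxy.
rewrite eqseq_cat // eqxx /= => /andP[/eqP ab /eqP /(IH _ suv) ->].
by case: a b ab => [] [] //= e; case: nxy; rewrite e.
Qed.

Definition cut_word T w : seq bool :=
  let p := flatten (nseq T w) in p ++ p ++ p ++ p.

Definition combine T (u v : seq bool) (w : seq bool) (acc : seq bool * seq bool) :=
  (padded (cut_word T w) acc.1 acc.2 u, padded (cut_word T w) acc.1 acc.2 v).

Lemma combine_neq T u v ws acc : size u = size v -> u <> v ->
  size acc.1 = size acc.2 -> acc.1 <> acc.2 ->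
  let c := foldr (combine T u v) acc ws in size c.1 = size c.2 /\ c.1 <> c.2.
Proof.
move=> suv nuv sacc nacc; elim: ws => [|w ws [IH1 IH2]] //=.
split; first by rewrite !size_padded // suv.
by move/(padded_inj IH1 IH2 suv).
Qed.

(** At the outermost cut where some node is avoidable, the padded identity holds
    whatever is inside; outside of it both sides substitute equal matrices
    into words of the same length. *)
Lemma combine_eval (R : realDomainType) n T u v ws acc (M : bool -> 'M[supertrop R]_n.+1) :
  size u = size v -> identity R n u v ->
  ((forall w s, w \in ws -> ~~ avoidable s (eval M w ^+ T) (eval M w ^+ T)) ->
   eval M acc.1 = eval M acc.2) ->
  eval M (foldr (combine T u v) acc ws).1 = eval M (foldr (combine T u v) acc ws).2.
Proof.
move=> suv huv; elim: ws => [|w ws IH] hacc /=; first exact: hacc.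
case: (boolP [exists s, avoidable s (eval M w ^+ T) (eval M w ^+ T)]) => [/existsP[s av]|].
  by apply: (@identity_padded _ _ _ _ _ s) => //; rewrite eval_flatten_nseq.
rewrite negb_exists => /forallP na.
suff e : eval M (foldr (combine T u v) acc ws).1 = eval M (foldr (combine T u v) acc ws).2.
  by rewrite !eval_padded // suv.
apply: IH => h; apply: hacc => w' s; rewrite inE => /orP[/eqP ->|]; first exact: na.
exact: h.
Qed.

Fixpoint words_upto m : seq (seq bool) :=
  if m is k.+1 then [::] :: map (cons true) (words_upto k) ++ map (cons false) (words_upto k)
  else [:: [::]].

Lemma mem_words_upto m w : (size w <= m)%N -> w \in words_upto m.
Proof.
elim: m w => [|m IH] [|z w] //= h.
by rewrite inE mem_cat; case: z; rewrite map_f ?IH ?orbT.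
Qed.

(** * An identity in every dimension *)

Section Unavoidable.
Variables (R : realDomainType) (n : nat).
Local Notation S := (supertrop R).
Implicit Types Z Q : bool -> 'M[S]_n.+1.

(** The word pq is completed to its N-th power, to which the hypothesis of
    dominance applies, by staying at s. *)
Lemma no_return_words Z (N m : nat) : (0 < N)%N ->
  (forall z s, Z z s s != 0) ->
  (forall z (sg : 'S_n.+1), sg != 1%g -> \prod_s Z z s (sg s) ≺ \prod_s Z z s s) ->
  (forall w, (size w <= m)%N -> (forall s, (eval Z w ^+ N) s s != 0) /\
     forall s x, x != s ->
       (eval Z w ^+ N) s x * (eval Z w ^+ N) x s ≺ ((eval Z w ^+ N) s s) ^+ 2) ->
  forall p q s x, (size p + size q <= m)%N -> x != s ->
    eval Z p s x * eval Z q x s ≺ eval Z (p ++ q) s s.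
Proof.
move=> N0 diag0 permdom dom p q s x pqm xs.
have [|B0 dom2] := dom (p ++ q); first by rewrite size_cat.
pose r := flatten (nseq N.-1 (p ++ q)).
have vE : flatten (nseq N (p ++ q)) = p ++ (q ++ r).
  by rewrite -{1}(prednK N0) /= -catA.
have vE' : flatten (nseq N (p ++ q)) = (p ++ q) ++ r by rewrite vE catA.
rewrite -eval_flatten_nseq in B0 dom2.
have := no_return diag0 permdom B0 dom2 vE xs; apply: contra => le.
rewrite /diag_weight vE' big_cat /=.
apply: (@st_le_trans _ (eval Z (p ++ q) s s * eval Z r s s)).
  by apply: st_leM; apply: diag_weight_le.
apply: st_le_trans (st_leM le (st_le_refl _)) _.
rewrite -mulrA; apply: st_leM (st_le_refl _) _.
by rewrite eval_cat; apply: mul_entry_le.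
Qed.

Lemma diag_mul Z z z' s :
  (forall x, x != s -> Z z s x * Z z' x s ≺ (Z z * Z z') s s) ->
  (Z z * Z z') s s = Z z s s * Z z' s s.
Proof.
move=> h; have [e0|n0] := eqVneq ((Z z * Z z') s s) 0.
  apply/esym/eqP; rewrite e0 -st_le0 -e0; exact: mul_entry_le.
have [k hk] := mul_entry_attained n0 (st_le_refl _).
have ks : k = s by apply/eqP; apply: contraT => /h; rewrite hk.
rewrite {}ks in hk; rewrite mxE (bigD1 s) //= st_lt_add_absorb //.
apply: contraTN (hk) => le.
have d0 : Z z s s * Z z' s s != 0.
  by apply: contra n0 => /eqP e; move: hk; rewrite e st_le0.
have [x xs hx] := st_sum_attained d0 le.
exact: st_le_lt_trans hx (h x xs).
Qed.

Definition centre_letter r c (b : bool) t := if t == c then b else (t %% r.+1 != r)%N.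

(** The word (A^r B)^(2r+1), where A stands for [true], with the B of its central
    block replaced by b.  If b is [false] it has period r + 1, and if b is
    [true] it is constant at distance at most r from the centre. *)
Definition centred r b : seq bool :=
  mkseq (centre_letter r (r * r.+1 + r) b) ((r + r).+1 * r.+1).

(** The periods are 1 for the central letter [true] and r + 1 for [false]. *)
Lemma centred_identity Q r :
  (r = 4 ^ #|{: 'I_n.+1 * 'I_n.+1}|)%N ->
  (forall s, Q true s s = Q false s s) ->
  (forall p q s x, (size p + size q <= (r + r).+1 * r.+1)%N -> x != s ->
    eval Q p s x * eval Q q x s ≺ eval Q (p ++ q) s s) ->
  eval Q (centred r true) = eval Q (centred r false).
Proof.
move=> rE diagQ nr; set l := ((r + r).+1 * r.+1)%N.
set c := (r * r.+1 + r)%N.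
pose W b t := Q (centre_letter r c b t).
have r0 : (0 < r)%N by rewrite rE expn_gt0.
have WE b a d : range_prod (W b) a d =
    eval Q (map (centre_letter r c b) (index_iota a d)).
  by rewrite /eval big_map.
have E b : eval Q (centred r b) = range_prod (W b) 0 l.
  by rewrite WE /centred /mkseq /index_iota subn0.
have noret b a d e s x : (a <= d)%N -> (d <= e)%N -> (e <= l)%N -> x != s ->
    range_prod (W b) a d s x * range_prod (W b) d e x s ≺ range_prod (W b) a e s s.
  move=> ad de el xs; rewrite (@range_prod_cat _ _ _ a d e) // !WE -eval_cat.
  by apply: nr; rewrite // !size_map !size_iota; lia.
have c1 : (c.+1 + r * r.+1 <= l)%N by rewrite /c /l; nia.
have perT t : (c - 1 * r <= t)%N -> (t + 1 < c.+1 + 1 * r)%N -> W true (t + 1)%N = W true t.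
  have run u : (c - r <= u)%N -> (u < c.+1 + r)%N -> centre_letter r c true u = true.
    rewrite /centre_letter; case: eqP => // uc h1 h2; apply/eqP => e.
    have := divn_eq u r.+1; rewrite e; set k := (u %/ r.+1)%N; rewrite /c in uc h1 h2 *.
    by move=> uE; have [|[|]] : (k < r \/ k = r \/ r < k)%N; nia.
  by rewrite !mul1n => h1 h2; rewrite /W !run //; lia.
have perF t : (c - r.+1 * r <= t)%N -> (t + r.+1 < c.+1 + r.+1 * r)%N ->
    W false (t + r.+1)%N = W false t.
  move=> _ _; have regular u : centre_letter r c false u = (u %% r.+1 != r)%N.
    rewrite /centre_letter; case: eqP => // ->.
    by rewrite /c modnMDl modn_small // eqxx.
  by rewrite /W !regular modnDr.
have cT : (1 * r <= c)%N by rewrite /c; lia.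
have cF : (r.+1 * r <= c)%N by rewrite /c; lia.
have lT : (c.+1 + 1 * r <= l)%N by apply: leq_trans c1; nia.
have lF : (c.+1 + r.+1 * r <= l)%N by rewrite mulnC.
rewrite rE in perT perF cT cF lT lF.
rewrite !E; apply/matrixP => i j.
rewrite (centre_diagonal (noret true) (ltn0Sn 0) cT lT perT).
rewrite (centre_diagonal (noret false) (ltn0Sn _) cF lF perF).
apply: eq_bigr => s _; congr (_ * _ * _).
- have -> // : range_prod (W true) 0 c = range_prod (W false) 0 c.
  by apply: eq_big_nat => t /andP[_ tc]; rewrite /W /centre_letter ltn_eqF.
- by rewrite /W /centre_letter eqxx diagQ.
- have -> // : range_prod (W true) c.+1 l = range_prod (W false) c.+1 l.
  by apply: eq_big_nat => t /andP[ct _]; rewrite /W /centre_letter gtn_eqF.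
Qed.

End Unavoidable.

Section Main.
Variable R : realDomainType.
Local Notation S := (supertrop R).

(** The words a^N b^N and b^N a^N: their matrices have the same diagonal as soon as
    no optimal closed walk along them leaves its node. *)
Definition blocks N : bool -> seq bool := fun z => nseq N z ++ nseq N (~~ z).

Lemma centred_neq r : centred r true <> centred r false.
Proof.
set c := (r * r.+1 + r)%N => e.
have cl : (c < (r + r).+1 * r.+1)%N by rewrite /c; nia.
have := congr1 (fun w => nth true w c) e.
by rewrite !nth_mkseq // /centre_letter eqxx.
Qed.

Lemma subst_blocks_neq N r : (0 < N)%N ->
  subst (blocks N) (centred r true) <> subst (blocks N) (centred r false).
Proof.
move=> N0; move: (@centred_neq r) => h e; apply: h.
move: e; have : size (centred r true) = size (centred r false) by rewrite !size_mkseq.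
elim: (centred r true) (centred r false) => [|a u IH] [|b v] //= [suv].
rewrite /subst /= => /eqP; rewrite eqseq_cat; last by rewrite !size_cat !size_nseq.
case/andP=> /eqP ab /eqP /(IH _ suv) ->; congr (_ :: _).
by move: ab; rewrite /blocks -(prednK N0) => -[].
Qed.

(** K bounds the orders of the permutations of the nodes, and L the times up to
    which dominance is needed; the cuts are w^T | w^T for every word w that is
    not longer than the substituted central words. *)
Theorem identity_exists n : exists u v : seq bool,
  [/\ size u = size v, u <> v & identity R n u v].
Proof.
elim: n => [|n [u [v [suv nuv huv]]]].
  exists [:: true], [:: false]; split=> // M.
  by apply/matrixP => -[].
pose q := #|{: 'I_n.+1 * 'I_n.+1}|.
pose N := q`!; pose K := n.+1`!; pose L := (K * N)%N; pose T := (q * L)%N.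
pose r := (4 ^ q)%N; pose l := ((r + r).+1 * r.+1)%N.
have N0 : (0 < N)%N by apply: fact_gt0.
have K0 : (0 < K)%N by apply: fact_gt0.
have L0 : (0 < L)%N by rewrite muln_gt0 K0.
have NL : (N <= L)%N by rewrite leq_pmull.
pose acc := (subst (blocks N) (centred r true), subst (blocks N) (centred r false)).
pose ws := words_upto (N * (2 * l)).
have sb z : size (blocks N z) = (2 * N)%N.
  by rewrite /blocks size_cat !size_nseq addnn mul2n.
have sacc : size acc.1 = size acc.2.
  by rewrite !(@size_subst_const _ _ _ (2 * N)) // !size_mkseq.
have nacc : acc.1 <> acc.2 by apply: subst_blocks_neq.
have [s1 s2] := @combine_neq T u v ws acc suv nuv sacc nacc.
exists (foldr (combine T u v) acc ws).1, (foldr (combine T u v) acc ws).2.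
split=> // M; apply: combine_eval => // na.
pose Z z := M z ^+ N.
have evZ w : eval M (subst (nseq N) w) = eval Z w.
  by rewrite eval_subst (eval_ext (M' := Z)) // => z; rewrite /= eval_nseq.
have domM z s := @unavoidable_dominance R n (M z) L T s L0 NL (erefl _).
have naM z s : ~~ avoidable s (M z ^+ T) (M z ^+ T).
  have := na [:: z] s; rewrite /eval big_seq1; apply.
  by apply: mem_words_upto; rewrite muln_gt0 N0 /l; lia.
have diag0 z s : Z z s s != 0 by have [] := domM z s (naM z s).
have permdom z (sg : 'S_n.+1) : sg != 1%g -> \prod_s Z z s (sg s) ≺ \prod_s Z z s s.
  apply: (@perm_dominance R n (Z z) K) => // s k k' x kK k'K xs.
  have [_ d] := domM z s (naM z s).
  by apply: d; rewrite ?leq_mul2r ?kK ?k'K ?orbT.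
have domW w : (size w <= 2 * l)%N -> (forall s, (eval Z w ^+ N) s s != 0) /\
    forall s x, x != s ->
      (eval Z w ^+ N) s x * (eval Z w ^+ N) x s ≺ ((eval Z w ^+ N) s s) ^+ 2.
  move=> wl.
  have naw s : ~~ avoidable s (eval Z w ^+ T) (eval Z w ^+ T).
    rewrite -evZ; apply: na; apply: mem_words_upto.
    rewrite (@size_subst_const _ _ _ N) ?leq_mul2l ?wl ?orbT // => z.
    exact: size_nseq.
  have dom s := @unavoidable_dominance R n (eval Z w) L T s L0 NL (erefl _) (naw s).
  split=> [s|s x xs]; first by have [] := dom s.
  have [_ /(_ 1%N 1%N x)] := dom s.
  by rewrite !mul1n !expr1; apply.
have nr := no_return_words N0 diag0 permdom domW.
pose Q z := eval Z [:: z; ~~ z].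
have QE z : Q z = Z z * Z (~~ z) by rewrite /Q eval_cons /eval big_seq1.
have accE b : eval M (subst (blocks N) (centred r b)) = eval Q (centred r b).
  rewrite eval_subst (eval_ext (M' := Q)) // => z.
  by rewrite /= /blocks eval_cat !eval_nseq QE.
rewrite /acc /= !accE; apply: centred_identity => // [s|p p' s x pl xs].
  have e1 y : eval Z [:: y] = Z y by rewrite /eval big_seq1.
  have e z : Q z s s = Z z s s * Z (~~ z) s s.
    rewrite QE; apply: diag_mul => x xs.
    have := nr [:: z] [:: ~~ z] s x; rewrite eval_cat !e1; apply => //.
    by rewrite /= /l; lia.
  by rewrite !e mulrC.
have eQ w : eval Q w = eval Z (subst (fun z => [:: z; ~~ z]) w) by rewrite eval_subst.
rewrite !eQ /subst map_cat flatten_cat; apply: nr => //.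
rewrite -/(subst _ p) -/(subst _ p') !(@size_subst_const _ _ _ 2) //.
by rewrite -mulnDr leq_mul2l pl orbT.
Qed.

End Main.

(** * From matrices to digraphs *)

Section TangibleSum.
Variables (R : realDomainType) (T : Type).

Lemma tangible_sum (f : T -> R) (s : seq T) :
  match \sum_(p <- s) (Some (f p, true) : supertrop R) with
  | None => s = [::]
  | Some (a, b) => [/\ has (fun p => f p == a) s, all (fun p => f p <= a) s
                     & b = (count (fun p => f p == a) s == 1%N)]
  end.
Proof.
elim: s => [|p s IH]; first by rewrite big_nil.
rewrite big_cons st_addE; move: IH.
case: (\sum_(_ <- _) _) => [[a b]|->] /=; last by rewrite eqxx lexx.
move=> [ha la ->]; case: (ltgtP (f p) a) => [lt|gt|e] /=.
- by rewrite lt_eqF // ha (ltW lt) la.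
- rewrite eqxx lexx; split=> //.
    by apply: sub_all la => x /le_trans; apply; apply: ltW.
  suff /eqP -> : count (fun x => f x == f p) s == 0%N by [].
  rewrite eqn0Ngt -has_count -all_predC.
  by apply: sub_all la => x xa /=; rewrite lt_eqF // (le_lt_trans xa).
- by rewrite e eqxx lexx la add1n eqSS; split=> //; move: ha; rewrite has_count; case: count.
Qed.

End TangibleSum.

Section Walks.
Variables (R : realType) (n : nat) (G : digraph R n).
Local Notation S := (supertrop R).

Definition transfer (z : letter) : 'M[S]_n :=
  \matrix_(i, k) match G i k z with
                 | NoArc => None
                 | SingleArc r => Some (r, true)
                 | DoubleArc r => Some (r, false)
                 end.

(** A list without repetition, so that a sum over it counts each walk once.  The
    empty walk at each node starts the recursion. *)
Fixpoint walk_list (i j : 'I_n) (w : seq letter) : seq (seq (Defs.arc n)) :=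
  if w is z :: w' then
    [seq e :: p | e <- [seq e <- enum (Defs.arc n) | [&& is_arc G e, src e == i & lab e == z]],
                  p <- walk_list (tgt e) j w']
  else if i == j then [:: [::]] else [::].

Lemma transferE z i k : transfer z i k =
  \sum_(e | [&& is_arc G e, src e == i & lab e == z] && (tgt e == k))
    (Some (arc_weight G e, true) : S).
Proof.
rewrite (reindex_onto (fun c : bool => (i, k, z, c)) (fun e => copy e)) /=; last first.
  by move=> [[[i' k'] z'] c] /= /andP[/and3P[_ /eqP <- /eqP <-] /eqP <-].
rewrite big_mkcond /= big_bool /is_arc /arc_weight /= !eqxx /= mxE.
by case: (G i k z) => [|r|r] /=; rewrite ?add0r // st_addE /= ltxx.
Qed.

Lemma eval_walk_list w i j : eval transfer w i j =
  \sum_(p <- walk_list i j w) (Some (walk_weight G p, true) : S).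
Proof.
elim: w i => [|z w IH] i /=.
  rewrite /eval big_nil mxE; case: eqP => _; last by rewrite big_nil.
  by rewrite big_seq1 /walk_weight big_nil.
rewrite eval_cons mxE big_allpairs_dep big_filter big_enum_cond /=.
rewrite (partition_big (fun e => tgt e) xpredT) //=.
apply: eq_bigr => k _; rewrite transferE big_distrl /=.
apply: eq_bigr => e /andP[_ /eqP <-]; rewrite IH big_distrr /=.
by apply: eq_bigr => p _; rewrite /walk_weight big_cons.
Qed.

Lemma walk_list_uniq i j w : uniq (walk_list i j w).
Proof.
elim: w i => [|z w IH] i /=; first by case: eqP.
apply: allpairs_uniq_dep => //; first exact/filter_uniq/enum_uniq.
by move=> [e p] [e' p'] _ _ /= [-> ->].
Qed.

Lemma mem_walk_list i j w p : w <> [::] ->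
  (p \in walk_list i j w) = is_walk G i j p && (walk_label p == w).
Proof.
suff h : (p \in walk_list i j w) =
    (if p is [::] then i == j else is_walk G i j p) && (walk_label p == w).
  by rewrite h; case: p {h} => //; case: w => //= z w _; rewrite andbF.
elim: w i p => [|z w IH] i p /=.
  by case: p => [|e p]; case: (i == j); rewrite ?inE ?andbF.
case: p => [|e p].
  by rewrite andbF; apply/negP => /allpairsPdep[e [q []]].
apply/allpairsPdep/idP => [[e' [q [+ + [-> ->]]]]|].
  rewrite mem_filter IH => /andP[/and3P[h1 h2 h3] _] /andP[h4 /eqP h5].
  rewrite /walk_label /= (eqP h3) -/(walk_label q) h5 eqxx andbT.
  case: q h4 {h5} => [|f q] /=; first by rewrite h1 h2.
  by case/and4P=> /andP[-> ->] /eqP -> -> ->; rewrite h1 h2 eqxx.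
rewrite /walk_label /= eqseq_cons -/(walk_label p).
case/andP=> hw /andP[h3 h5].
exists e, p; split=> //; first by rewrite mem_filter mem_enum h3 andbT; case/and3P: hw => /andP[-> _] ->.
rewrite IH h5 andbT.
case: p hw {h5} => [|f p] /=; first by case/and3P.
by case/and4P=> /and3P[_ -> ->] _ /andP[/eqP -> ->] ->; rewrite eqxx.
Qed.

Definition value (x : S) : \bar R := if x is Some (a, _) then a%:E else -oo%E.

Lemma walks_list i j w p : w <> [::] -> walks G i j w p <-> p \in walk_list i j w.
Proof.
move=> w0; rewrite mem_walk_list //; split=> [[-> ->]|/andP[h /eqP e]]; last by split.
by rewrite eqxx.
Qed.

Lemma highest_weightE i j w : w <> [::] ->
  highest_weight G i j w = value (eval transfer w i j).
Proof.
move=> w0; rewrite eval_walk_list; have := tangible_sum (walk_weight G) (walk_list i j w).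
case: (\sum_(_ <- _) _) => [[a b] [/hasP[p0 p0l /eqP p0a] /allP la _]|e] /=; last first.
  apply: highest_weight_empty; rewrite -subset0 => p /(walks_list _ _ _ w0).
  by rewrite e.
apply/eqP; rewrite eq_le; apply/andP; split.
  apply: ge_ereal_sup => _ [p /(walks_list _ _ _ w0) pl <-]; rewrite lee_fin.
  exact: la.
apply: ereal_sup_ubound; exists p0; last by rewrite p0a.
exact/(walks_list _ _ _ w0).
Qed.

Lemma unique_highest_walkE i j w : w <> [::] ->
  (exists! p, highest_walk G i j w p) <-> ~~ ghost (eval transfer w i j).
Proof.
move=> w0; rewrite /highest_walk highest_weightE // eval_walk_list.
have := tangible_sum (walk_weight G) (walk_list i j w).
have un := walk_list_uniq i j w.
case: (\sum_(_ <- _) _) => [[a b] [ha la ->]|e] /=; last first.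
  split=> // -[p [[/(walks_list _ _ _ w0)]]]; by rewrite e.
have hwE p : walks G i j w p /\ (walk_weight G p)%:E = a%:E <->
    p \in [seq p <- walk_list i j w | walk_weight G p == a].
  rewrite mem_filter; split=> [[/(walks_list _ _ _ w0) -> [->]]|/andP[/eqP -> /(walks_list _ _ _ w0)]] //.
  by rewrite eqxx.
have := filter_uniq (fun p => walk_weight G p == a) un.
rewrite -size_filter; move: hwE; set s := [seq p <- _ | _]; clearbody s => hwE us.
have -> : ~~ (if size s == 1%N then false else true) = (size s == 1%N) by case: eqP.
split=> [[p [/hwE ps up]]|].
  have : {subset s <= [:: p]} by move=> x /hwE /up ->; rewrite inE.
  move=> /(uniq_leq_size us) /=; case: s ps {us up hwE} => // x [|] //.
case: s us hwE => [|p [|]] // _ hwE _; exists p; split; first by apply/hwE; rewrite inE.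
by move=> p' /hwE; rewrite inE => /eqP ->.
Qed.

End Walks.

Theorem corollary3p7 (R : realType) :
  (forall (n : nat) (G : digraph R n),
     exists u v : seq letter,
       [/\ u <> [::], v <> [::], u <> v,
           same_highest_weights G u v
         & unique_highest_walk_transfer G u v])
  /\
  (forall n : nat, (1 <= n)%N ->
     exists u v : seq letter,
       [/\ u <> [::], v <> [::], u <> v
         & forall G : digraph R n,
             same_highest_weights G u v /\ unique_highest_walk_transfer G u v]).
Proof.
have main n : exists u v : seq letter,
    [/\ u <> [::], v <> [::], u <> v & forall G : digraph R n,
       same_highest_weights G u v /\ unique_highest_walk_transfer G u v].
  have [u [v [suv nuv huv]]] := identity_exists R n.
  have u0 : u <> [::] by move=> e; move: suv nuv; rewrite e; case: v {huv}.
  have v0 : v <> [::] by move=> e; move: suv nuv; rewrite e; case: u {huv u0}.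
  exists u, v; split=> // G; split=> i j; first by rewrite !highest_weightE // huv.
  by move=> /(unique_highest_walkE _ _ _ u0); rewrite huv => /(unique_highest_walkE _ _ _ v0).
split=> [n G|n _]; last exact: main.
by have [u [v [? ? ? /(_ G)[? ?]]]] := main n; exists u, v.
Qed.
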